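(* Let $T=T_0+1$. Suppose (autoregressive model) that for each $i=1,\dots,N$, $$Y^N_{iT}(x)=\sum_{t=1}^{T_0}\langle\beta_t(x,\cdot),Y^N_{it}\rangle_{\mathcal H}+\varepsilon_{iT}(x),\qquad x\in\mathcal X,$$ where $\beta_t\in L^2(\mathcal X\times\mathcal X,\mu\otimes\mu)$, $t=1,\dots,T_0$, are coefficient functions, and $\varepsilon_{1T},\dots,\varepsilon_{NT}$ are independent, mean-zero $\mathcal H$-valued random elements with $\|\varepsilon_{iT}\|_{\mathcal H}\le\sigma$ almost surely for a constant $\sigma>0$. The pre-treatment outcomes $Y_{it}$ ($t\le T_0$) are treated as fixed, and $\hat\gamma=(\hat\gamma_2,\dots,\hat\gamma_N)\in\mathbb R^{N-1}$ is a fixed (non-random) weight vector with $\sum_{i=2}^N\hat\gamma_i=1$. Let $\hat\nu^N_{1T}$ be the generic weighting estimator built from $\hat\gamma$. Then for any $\delta>0$, with probability at least $1-2e^{-\delta^2/2}$, $$d(\nu^N_{1T},\hat\nu^N_{1T})\le\sqrt{\sum_{t=1}^{T_0}\|\beta_t\|^2_{\mathcal H\times\mathcal H}}\sqrt{\sum_{t=1}^{T_0}\Big\|Y_{1t}-\sum_{i=2}^N\hat\gamma_iY_{it}\Big\|_{\mathcal H}^2}+\delta\sigma(1+\|\hat\gamma\|_2).$$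
   Context: Let $(\mathcal X,\mathcal A,\mu)$ be either a compact interval $\mathcal I\subset\mathbb R$ with Lebesgue measure or the finite set $\{1,\dots,d\}$ with counting measure, and let $\mathcal H=L^2(\mathcal X,\mathcal A,\mu)$ (so $\mathcal H=L^2(\mathcal I)$ or $\mathcal H=\mathbb R^d$), with inner product $\langle f,g\rangle_{\mathcal H}=\int_{\mathcal X}fg\,d\mu$ and norm $\|\cdot\|_{\mathcal H}$. $(\mathcal M,d)$ is a metric space and $\Psi:\mathcal M\to\mathcal H$ is an isometry, $d(a,b)=\|\Psi(a)-\Psi(b)\|_{\mathcal H}$; its image $\mathcal Y=\Psi(\mathcal M)$ is nonempty, closed and convex in $\mathcal H$. Panel setting: units $i=1,\dots,N$, periods $t=1,\dots,T$, $1\le T_0<T$; transformed control potential outcomes $Y^N_{it}\in\mathcal Y$ and observed outcomes $Y_{it}\in\mathcal Y$ with $Y_{it}=Y^N_{it}$ whenever $i\ge2$ or $t\le T_0$; the counterfactual of interest is $\nu^N_{1T}=\Psi^{-1}(Y^N_{1T})$. Generic weighting estimator: given weights $\hat\gamma\in\mathbb R^{N-1}$ with $\sum_{i=2}^N\hat\gamma_i=1$ not depending on the post-treatment outcomes, set $\hat Y^N_{1T}=\sum_{i=2}^N\hat\gamma_iY_{iT}$, $\tilde Y^N_{1T}=\arg\min_{y\in\mathcal Y}\|y-\hat Y^N_{1T}\|_{\mathcal H}$ (the metric projection onto $\mathcal Y$), and $\hat\nu^N_{1T}=\Psi^{-1}(\tilde Y^N_{1T})$. For $\beta\in L^2(\mathcal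 X\times\mathcal X)$, $\|\beta\|_{\mathcal H\times\mathcal H}=\big(\int_{\mathcal X}\int_{\mathcal X}\beta(x,y)^2\,d\mu(x)d\mu(y)\big)^{1/2}$. *)

(* Defs.v *)
From HB Require Import structures.
From mathcomp Require Import all_boot all_order all_algebra.
From mathcomp Require Import all_classical all_reals all_analysis.
Set Implicit Arguments. Unset Strict Implicit. Unset Printing Implicit Defensive.
Import Order.TTheory GRing.Theory Num.Theory.
Local Open Scope classical_set_scope.
Local Open Scope ring_scope.

(* The space (X, A, mu): X = D ⊆ R, with mu a measure on (Borel sets of) R.
   Elements of H = L^2(X) are represented by real functions on R (only their
   values on D matter); equality in H is equality mu-a.e. on D. *)

Definition base_space {R : realType} (D : set R)
  (mu : {measure set (measurableTypeR R) -> \bar R}) : Prop :=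
  (exists a b : R, a < b /\ D = `[a, b]%classic /\ (forall A, mu A = lebesgue_measure A))
  \/ (exists d : nat, (0 < d)%N /\
        D = [set x | exists2 k : nat, (1 <= k <= d)%N & x = k%:R] /\
        (forall A, mu A = counting A)).

Section L2.
Context {R : realType} (D : set R) (mu : {measure set (measurableTypeR R) -> \bar R}).

Definition inH (f : R -> R) : Prop :=
  measurable_fun D f /\ (\int[mu]_(x in D) ((f x) ^+ 2)%:E < +oo)%E.

Definition ipH (f g : R -> R) : R := fine (\int[mu]_(x in D) (f x * g x)%:E).

Definition normH (f : R -> R) : R := Num.sqrt (fine (\int[mu]_(x in D) ((f x) ^+ 2)%:E)).

Definition eqH (f g : R -> R) : Prop := f = g %[ae mu in D].

Definition inHH (beta : R * R -> R) : Prop :=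
  measurable_fun (D `*` D) beta /\
  (\int[mu]_(x in D) \int[mu]_(y in D) ((beta (x, y)) ^+ 2)%:E < +oo)%E.

Definition normHH (beta : R * R -> R) : R :=
  Num.sqrt (fine (\int[mu]_(x in D) \int[mu]_(y in D) ((beta (x, y)) ^+ 2)%:E)).
End L2.

Section Random.
Context {R : realType} (D : set R) (mu : {measure set (measurableTypeR R) -> \bar R})
  {dO : measure_display} {Omega : measurableType dO} (P : probability Omega R).

(* An H-valued random element: each realization is in H and every linear
   functional <., h>, h ∈ H, of it is a real random variable (weak
   measurability; equivalent to Borel measurability since H is separable). *)
Definition H_random_element (e : Omega -> R -> R) : Prop :=
  (forall w, inH D mu (e w)) /\
  (forall h, inH D mu h -> measurable_fun setT (fun w => ipH D mu (e w) h)).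

Definition gen_sigma (e : Omega -> R -> R) : set (set Omega) :=
  smallest (sigma_algebra setT)
    [set A | exists h, inH D mu h /\
       exists2 B : set R, measurable B & A = (fun w => ipH D mu (e w) h) @^-1` B].

Definition mean_zero (e : Omega -> R -> R) : Prop :=
  forall h, inH D mu h -> (\int[P]_w (ipH D mu (e w) h)%:E = 0)%E.

Definition mutually_independent (N : nat) (e : nat -> Omega -> R -> R) : Prop :=
  forall E : nat -> set Omega,
    (forall i, (1 <= i <= N)%N -> gen_sigma (e i) (E i)) ->
    P (\bigcap_(i in [set i | (1 <= i <= N)%N]) E i) =
    (\prod_(1 <= i < N.+1) P (E i))%E.
End Random.

(* Main.v *)
Require Import Defs.
From HB Require Import structures.
From mathcomp Require Import all_boot all_order all_algebra.
From mathcomp Require Import all_classical all_reals all_analysis.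
From mathcomp Require Import measurable_realfun ring lra.
Import Order.TTheory GRing.Theory Num.Theory.
Import numFieldNormedType.Exports.
Local Open Scope classical_set_scope.
Local Open Scope ring_scope.

(** Projecting onto a convex set brings its points closer, so the distance is at
    most the norm of [Y_1T - sum gamma_i Y_iT]; the autoregressive part of the
    latter is controlled by Cauchy-Schwarz.  The noise part is
    [S = eps_1 - sum gamma_i eps_i], a sum of independent centred vectors, and
    Pinelis' inequality [P (|S| > delta B) <= 2 exp (- delta^2 / 2)] applies
    with [B = sigma sqrt (1 + |gamma|^2)].

    Pinelis' bound follows from [E cosh |S_m| <= prod cosh c_i], proved by
    induction on [m].  Since [s |-> cosh (sqrt s)] is convex and nondecreasing,
    [cosh |x + d| <= cosh |x| cosh c + (<x, d> / (|x| c)) sinh |x| sinh c] when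
    [|d| <= c], and the last term has mean zero when [d] is centred and
    independent of [x].

    The errors being only weakly measurable, all this is done for the projections
    on finite orthonormal families [phi_n] (normalised indicators of a uniform
    partition, or of the points of a finite set).  The expansion of [f] along
    [phi_n] converges to [f] almost everywhere by Lebesgue differentiation, so by
    Fatou's lemma [|f|] is bounded by [r] as soon as infinitely many of the
    projections are. *)

(** * Hyperbolic functions *)

Definition cosh {R : realType} (x : R) : R := (expR x + expR (- x)) / 2.
Definition sinh {R : realType} (x : R) : R := (expR x - expR (- x)) / 2.

Section hyperbolic.
Context {R : realType}.
Implicit Types x y u v c t : R.

Lemma cosh0 : cosh (0 : R) = 1.
Proof. by rewrite /cosh oppr0 expR0; lra. Qed.

Lemma sinh0 : sinh (0 : R) = 0.
Proof. by rewrite /sinh oppr0 expR0 subrr mul0r. Qed.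

Lemma coshN x : cosh (- x) = cosh x.
Proof. by rewrite /cosh opprK addrC. Qed.

Lemma coshD x y : cosh (x + y) = cosh x * cosh y + sinh x * sinh y.
Proof. by rewrite /cosh /sinh opprD !expRD; field. Qed.

Lemma coshB x y : cosh (x - y) = cosh x * cosh y - sinh x * sinh y.
Proof. by rewrite /cosh /sinh opprD !opprK !expRD; field. Qed.

Lemma is_derive_cosh x : is_derive x 1 (@cosh R) (sinh x).
Proof.
have -> : @cosh R = (2^-1 : R) \*: (@expR R + (@expR R \o -%R)).
  by apply/funext => y; rewrite /cosh /= [RHS]mulrC.
apply: is_derive_eq; rewrite /sinh /= /GRing.scale /=; ring.
Qed.

Lemma is_derive_sinh x : is_derive x 1 (@sinh R) (cosh x).
Proof.
have -> : @sinh R = (2^-1 : R) \*: (@expR R - (@expR R \o -%R)).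
  by apply/funext => y; rewrite /sinh /= [RHS]mulrC.
apply: is_derive_eq; rewrite /cosh /= /GRing.scale /=; ring.
Qed.

Lemma sinh_ge0 x : 0 <= x -> 0 <= sinh x.
Proof.
by move=> x0; rewrite /sinh divr_ge0 // subr_ge0 ler_expR; lra.
Qed.

Lemma derive_within_continuous (f f' : R -> R) (a b : R) :
  (forall x, is_derive x 1 f (f' x)) -> {within `[a, b], continuous f}.
Proof.
move=> fd; apply: continuous_subspaceT => x.
by apply: differentiable_continuous; apply/derivable1_diffP; case: (fd x).
Qed.

Lemma mean_value (f f' : R -> R) (a b : R) : a <= b ->
  (forall x, is_derive x 1 f (f' x)) ->
  exists2 c, a <= c <= b & f b - f a = f' c * (b - a).
Proof.
move=> ab fd.
have fc : {within `[a, b], continuous f} by exact: derive_within_continuous fd.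
have [c cab ->] := MVT_segment ab (fun x _ => fd x) fc.
by exists c.
Qed.

Lemma cosh_gt0 x : 0 < cosh x.
Proof. by rewrite /cosh divr_gt0 // addr_gt0 // expR_gt0. Qed.

Lemma ler_cosh x y : 0 <= x -> x <= y -> cosh x <= cosh y.
Proof.
move=> x0 xy; have [c /andP[xc cy] e] := mean_value _ _ _ _ xy is_derive_cosh.
by rewrite -subr_ge0 e mulr_ge0 ?subr_ge0 // sinh_ge0 // (le_trans x0).
Qed.

Lemma cosh_ge1 x : 1 <= cosh x.
Proof.
rewrite -cosh0; have [x0|x0] := leP 0 x; first exact: ler_cosh.
by rewrite -(coshN x); apply: ler_cosh => //; lra.
Qed.

Lemma sinh_le_mul_cosh x : 0 <= x -> sinh x <= x * cosh x.
Proof.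
move=> x0; have [c /andP[c0 cx]] := mean_value _ _ _ _ x0 is_derive_sinh.
rewrite sinh0 !subr0 => ->; rewrite mulrC.
by apply: ler_wpM2l => //; exact: ler_cosh.
Qed.

(** Convexity of [sinh] on the half-line and [sinh 0 = 0] make [sinh t / t] nondecreasing; the
    division is cleared so that 0 is allowed. *)
Lemma sinh_star_shaped t v : 0 <= t -> t <= v -> v * sinh t <= t * sinh v.
Proof.
move=> t0 tv; have [c /andP[c0 ct]] := mean_value _ _ _ _ t0 is_derive_sinh.
rewrite sinh0 !subr0 => e1.
have [c' /andP[c'0 c't] e2] := mean_value _ _ _ _ tv is_derive_sinh.
have : cosh c <= cosh c' by apply: ler_cosh => //; exact: le_trans c'0.
move=> h; rewrite -subr_ge0.
have -> : t * sinh v - v * sinh t = t * (v - t) * (cosh c' - cosh c).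
  have -> : sinh v = cosh c' * (v - t) + sinh t by rewrite -e2; ring.
  by rewrite e1; ring.
by rewrite !mulr_ge0 // subr_ge0.
Qed.

(* The graph of [s |-> cosh (sqrt s)] lies above its tangent at [s = v ^+ 2]. *)
Lemma cosh_sqr_tangent t v : 0 <= t -> 0 < v ->
  cosh v + (t ^+ 2 - v ^+ 2) * (sinh v / (2 * v)) <= cosh t.
Proof.
move=> t0 v0; set k := sinh v / (2 * v).
have kv : 2 * k * v = sinh v by rewrite /k; field; rewrite gt_eqF.
(* Up to a constant, [g] is the gap between the graph and its tangent. As [sinh t / t] is
   nondecreasing and equals [2 * k] at [v], the derivative [g'] is nonpositive before [v] and
   nonnegative after it, so [g] is least at [v]. *)
pose g := (fun t => cosh t - k * t ^+ 2) : R -> R.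
pose g' := (fun t => sinh t - 2 * k * t) : R -> R.
have gd x : is_derive x 1 g (g' x).
  have h := is_derive_cosh x.
  have -> : g = @cosh R - k \*: (@GRing.exp R ^~ 2%N).
    by apply/funext => z; rewrite /g.
  by apply: is_derive_eq; rewrite /g' /GRing.scale /=; ring.
suff : g v <= g t by rewrite /g; lra.
have [tv|/ltW vt] := leP t v.
- have [c /andP[tc cv] e] := mean_value _ _ _ _ tv gd.
  rewrite -subr_le0 e mulr_le0_ge0 ?subr_ge0 //.
  rewrite /g' subr_le0 -(ler_pM2l v0).
  apply: le_trans (sinh_star_shaped c v (le_trans t0 tc) cv) _.
  by rewrite -kv; lra.
- have [c /andP[vc ct] e] := mean_value _ _ _ _ vt gd.
  rewrite -subr_ge0 e mulr_ge0 ?subr_ge0 //.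
  rewrite -(ler_pM2l v0).
  apply: le_trans (sinh_star_shaped v c (ltW v0) vc).
  by rewrite -kv; lra.
Qed.

(* Euclid's law of cosines against the hyperbolic one. *)
Lemma cosh_cosines u c y v : 0 <= u -> 0 <= c -> -1 <= y <= 1 -> 0 <= v ->
  v ^+ 2 <= u ^+ 2 + c ^+ 2 + 2 * y * u * c ->
  cosh v <= cosh u * cosh c + y * (sinh u * sinh c).
Proof.
move=> u0 c0 /andP[y1 y2] v0 vle.
(* [s] is the third side of the Euclidean triangle, the largest value that [v] can take. *)
pose s := Num.sqrt (u ^+ 2 + c ^+ 2 + 2 * y * u * c).
have ss : s ^+ 2 = u ^+ 2 + c ^+ 2 + 2 * y * u * c.
  by rewrite sqr_sqrtr // (le_trans _ vle) // sqr_ge0.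
have vs : v <= s.
  by rewrite -(@ler_pXn2r _ 2) ?nnegrE ?sqrtr_ge0 // ss.
apply: le_trans (ler_cosh _ _ v0 vs) _.
(* The right-hand side is the mean of [cosh (u - c)] and [cosh (u + c)] with weights [(1 - y) / 2]
   and [(1 + y) / 2], and [s ^+ 2] is the same mean of the two squares. Jensen's inequality follows
   from the tangent at [s], whose first-order terms cancel. *)
have -> : cosh u * cosh c + y * (sinh u * sinh c) =
  (1 - y) / 2 * cosh (u - c) + (1 + y) / 2 * cosh (u + c).
  by rewrite coshB coshD; field.
have [s0|s0] := eqVneq s 0.
  rewrite s0 cosh0; have := cosh_ge1 (u - c); have := cosh_ge1 (u + c).
  by move=> h1 h2; nra.
have {}s0 : 0 < s by rewrite lt_neqAle eq_sym s0 sqrtr_ge0.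
set k := sinh s / (2 * s).
have coshabs (z : R) : cosh `|z| = cosh z.
  by have [z0|z0] := leP 0 z; [rewrite ger0_norm|rewrite ltr0_norm // coshN].
have h1 := cosh_sqr_tangent `|u - c| s (normr_ge0 _) s0.
have h2 := cosh_sqr_tangent `|u + c| s (normr_ge0 _) s0.
rewrite !coshabs !real_normK ?num_real // -/k in h1 h2; clearbody k.
have e : (1 - y) / 2 * ((u - c) ^+ 2 - s ^+ 2) + (1 + y) / 2 * ((u + c) ^+ 2 - s ^+ 2) = 0.
  by rewrite ss; field.
have p1 : 0 <= (1 - y) / 2 by lra.
have p2 : 0 <= (1 + y) / 2 by lra.
apply: le_trans (lerD (ler_wpM2l p1 h1) (ler_wpM2l p2 h2)).
rewrite le_eqVlt; apply/orP; left; apply/eqP.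
by rewrite -[LHS]addr0 -[X in _ + X](mul0r k) -e; field.
Qed.

(** The quotient of the two sides is nonincreasing on the half-line: its derivative has the sign of
    [sinh t - t * cosh t]. *)
Lemma cosh_le_expR x : cosh x <= expR (x ^+ 2 / 2).
Proof.
wlog x0 : x / 0 <= x => [H|].
  have [/H//|x0] := leP 0 x.
  by rewrite -coshN -(sqrrN x); apply: H; lra.
pose g := (fun t => cosh t * expR (- (t ^+ 2 / 2))) : R -> R.
pose g' := (fun t => (sinh t - t * cosh t) * expR (- (t ^+ 2 / 2))) : R -> R.
have gd (z : R) : is_derive z 1 g (g' z).
  have h := is_derive_cosh z.
  have -> : g = @cosh R * (@expR R \o ((- 2^-1) \*: (@GRing.exp R ^~ 2%N))).
    apply/funext => w; congr (_ * expR _).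
    by rewrite /= /GRing.scale /=; field. 
  apply: is_derive_eq; rewrite /g' /= /GRing.scale /=.
  have -> : - 2^-1 * z ^+ 2 = - (z ^+ 2 / 2) by rewrite mulrC mulrN.
  by field.
have [c /andP[c0 _] e] := mean_value _ _ _ _ x0 gd.
have : g x <= g 0.
  rewrite -subr_le0 e mulr_le0_ge0 ?subr0 // /g'.
  by rewrite mulr_le0_ge0 ?expR_ge0 // subr_le0 sinh_le_mul_cosh.
rewrite /g cosh0 expr0n /= mul0r oppr0 expR0 mulr1 expRN.
by rewrite ler_pdivrMr ?expR_gt0 // mul1r.
Qed.

End hyperbolic.

(** * Independence of the past *)

Lemma bounded_measurable_integrable d (T : measurableType d) (R : realType)
    (P : probability T R) (f : T -> R) (M : R) :
  measurable_fun setT f -> (forall w, `|f w| <= M) ->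
  P.-integrable setT (EFin \o f).
Proof.
move=> mf fM; apply: measurable_bounded_integrable => //.
  by have := probability_setT P; rewrite /= => ->; rewrite ltry.
by exists M; split; [exact: num_real|move=> x Mx y _; exact: le_trans (fM y) (ltW Mx)].
Qed.

Section independence.
Context d (T : measurableType d) (R : realType) (P : probability T R).

(** Independence makes the law of the pair [(F, Z)] the product of the two laws, because a product
    measure is determined by rectangles. By Fubini's theorem the integral over [Z] may be taken
    first, and it vanishes. *)
Lemma independent_integral_mul0 (F Z : T -> R) :
  P.-integrable setT (EFin \o F) -> P.-integrable setT (EFin \o Z) ->
  (forall A B, measurable A -> measurable B ->
     P (F @^-1` A `&` Z @^-1` B) = (P (F @^-1` A) * P (Z @^-1` B))%E) ->
  (\int[P]_w (Z w)%:E = 0)%E ->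
  P.-integrable setT (EFin \o (F \* Z)) ->
  (\int[P]_w (F w * Z w)%:E = 0)%E.
Proof.
move=> iF iZ FZ Z0 iFZ.
have mF : measurable_fun setT F by apply/measurable_EFinP; exact: measurable_int iF.
have mZ : measurable_fun setT Z by apply/measurable_EFinP; exact: measurable_int iZ.
pose X : {mfun T >-> R} := HB.pack F (isMeasurableFun.Build _ _ _ _ F mF).
pose Y : {mfun T >-> R} := HB.pack Z (isMeasurableFun.Build _ _ _ _ Z mZ).
have mXY : measurable_fun setT (fun w => (F w, Z w)) by exact: measurable_fun_pair.
pose XY : {mfun T >-> (R * R)%type} :=
  HB.pack (fun w => (F w, Z w)) (isMeasurableFun.Build _ _ _ _ _ mXY).
pose f (z : R * R) := (z.1 * z.2)%:E.
have fE x y : f (x, y) = (x%:E * y%:E)%E by [].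
have mf : measurable_fun setT f.
  by apply/measurable_EFinP; apply: measurable_funM.
have mu_eq : forall A : set (R * R), measurable A ->
    (distribution P X \x distribution P Y)%E A = distribution P XY A.
  by apply: product_measure_unique => A B mA mB; rewrite -FZ.
(* By Tonelli, the double integral of [|x y|] factors into the two first absolute moments. *)
have intf : ((distribution P X \x distribution P Y)%E).-integrable setT f.
  apply/integrable12ltyP => //=.
  have -> : (fun x => \int[distribution P Y]_y `|f (x, y)|)%E =
            (fun x => `|x%:E| * \int[distribution P Y]_y `|y%:E|)%E.
    apply/funext => x.
    under eq_integral do rewrite fE abseM.
    by rewrite ge0_integralZl //; exact: measurableT_comp.
  rewrite ge0_integralZr //; [|exact: measurableT_comp|exact: integral_ge0].
  rewrite !ge0_integral_distribution //; [|exact: measurableT_comp..].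
  have /integrableP[_ hF] := iF; have /integrableP[_ hZ] := iZ.
  apply: lte_mul_pinfty; [|rewrite ge0_fin_numE; first exact: hF|].
  - by apply: integral_ge0 => w _; exact: abse_ge0.
  - by apply: integral_ge0 => w _; exact: abse_ge0.
  - exact: hZ.
transitivity (\int[distribution P XY]_z f z)%E.
  by rewrite integral_distribution.
rewrite (eq_measure_integral (distribution P X \x distribution P Y)%E); last first.
  by move=> A mA _; symmetry; exact: mu_eq.
rewrite -integral12_prod_meas1 // /fubini_F /=.
under eq_integral => x _.
  under eq_integral do rewrite fE.
  rewrite integralZl //; last first.
    by apply: integrable_pushforward.
  rewrite integral_distribution // (_ : \int[P]_x (EFin \o Y) x = 0)%E // mule0; over.
by rewrite integral0.
Qed.

Variables (G : nat -> set (set T)) (N : nat).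
Hypothesis Gm : forall i, (1 <= i <= N)%N -> <<s G i >> `<=` measurable.
Hypothesis indep : forall E : nat -> set T,
  (forall i, (1 <= i <= N)%N -> <<s G i >> (E i)) ->
  P (\bigcap_(i in [set i | (1 <= i <= N)%N]) E i) =
  (\prod_(1 <= i < N.+1) P (E i))%E.

(** A pi-system that generates the joint sigma-algebra of the first [m] families; being closed under
    intersection is what the uniqueness theorem for measures asks for. *)
Definition past m : set (set T) :=
  [set A | exists2 E : nat -> set T,
     (forall i, (1 <= i <= m)%N -> <<s G i >> (E i)) &
     A = \bigcap_(i in [set i | (1 <= i <= m)%N]) E i].

Lemma past_measurable m : (m <= N)%N -> past m `<=` measurable.
Proof.
move=> mN A [E GE ->]; apply: fin_bigcap_measurable.
  by apply: (sub_finite_set _ (finite_II m.+1)) => i /= /andP[].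
move=> i /= /andP[i1 im]; apply: (Gm i); first by rewrite i1 (leq_trans im).
by apply: GE; rewrite i1.
Qed.

Lemma setI_closed_past m : setI_closed (past m).
Proof.
move=> A B [E GE ->] [E' GE' ->]; exists (fun i => E i `&` E' i).
  move=> i im; apply: (@measurableI _ (g_sigma_algebraType (G i))).
    exact: GE.
  exact: GE'.
by rewrite bigcapI.
Qed.

Lemma sub_past m i : (1 <= i <= m)%N -> <<s G i >> `<=` past m.
Proof.
move=> im A GA; exists (fun i' => if i' == i then A else setT).
  move=> i' _; case: eqP => [->//|_].
  exact: (@measurableT _ (g_sigma_algebraType (G i'))).
rewrite eqEsubset; split => [x Ax i' _|x /(_ i im)]; last by rewrite eqxx.
by case: eqP.
Qed.

Lemma measurable_past m i (f : T -> R) : (1 <= i <= m)%N ->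
  measurable_fun (setT : set (g_sigma_algebraType (G i))) f ->
  measurable_fun (setT : set (g_sigma_algebraType (past m))) f.
Proof.
move=> im mf _ Y mY; apply: sub_sigma_algebra; apply: (sub_past m i im).
by apply: mf => //; exact: measurableT.
Qed.

Lemma past_setT m : past m setT.
Proof.
exists (fun=> setT); last by rewrite bigcapT.
move=> i _; exact: (@measurableT _ (g_sigma_algebraType (G i))).
Qed.

(** With [B] fixed, [A |-> P (A & B)] and [A |-> P A * P B] are finite measures that agree on the
    pi-system [past m], hence on the sigma-algebra it generates. *)
Lemma past_indep m A B : (m < N)%N -> <<s past m >> A -> <<s G m.+1 >> B ->
  P (A `&` B) = (P A * P B)%E.
Proof.
move=> mN sA sB.
have mB : measurable B by apply: (Gm m.+1).
have PBn : 0 <= fine (P B) by rewrite fine_ge0.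
pose m2 := mscale (NngNum PBn) P.
have -> : (P A * P B)%E = m2 A.
  by rewrite /m2 /= /mscale /= muleC fineK // fin_num_measure.
rewrite -[LHS]/(mrestr P mB A).
apply: (g_sigma_algebra_measure_unique (past m) _ (fun=> setT)) => //.
- by apply: past_measurable; exact: ltnW.
- by move=> _; exact: past_setT.
- by rewrite bigcup_const.
- exact: setI_closed_past.
- move=> _ [E GE ->]; rewrite /m2 /= /mscale /= fineK ?fin_num_measure //.
  rewrite /mrestr.
  (* Both families are padded with the full event up to index [N], so that joint independence
     applies; they differ only at [m.+1], where [E1] has [B]. Comparing the two products leaves the
     factor [P B]. *)
  pose E1 i := if i == m.+1 then B else if (i <= m)%N then E i else setT.
  pose E2 i := if (i <= m)%N then E i else setT.
  have T_ i : <<s G i >> setT by exact: (@measurableT _ (g_sigma_algebraType (G i))).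
  have h1 := indep E1; have h2 := indep E2.
  have prodE (F : nat -> \bar R) : (\prod_(1 <= i < N.+1) F i =
      (\prod_(1 <= i < m.+1) F i) * F m.+1 * \prod_(m.+2 <= i < N.+1) F i)%E.
    rewrite (@big_cat_nat _ _ _ m.+1) //=; last by rewrite ltnW.
    by rewrite [X in (_ * X)%E]big_ltn // muleA.
  rewrite prodE in h1; rewrite prodE in h2.
  have -> : \bigcap_(i in [set i | (1 <= i <= m)%N]) E i =
            \bigcap_(i in [set i | (1 <= i <= N)%N]) E2 i.
    rewrite eqEsubset; split => x Ex i /= /andP[i1 im].
      by rewrite /E2; case: ifPn => // im'; apply: Ex; rewrite /= i1.
    have := Ex i; rewrite /= i1 (leq_trans im (ltnW mN)) => /(_ erefl).
    by rewrite /E2 im.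
  have -> : \bigcap_(i in [set i | (1 <= i <= N)%N]) E2 i `&` B =
            \bigcap_(i in [set i | (1 <= i <= N)%N]) E1 i.
    rewrite eqEsubset; split => x.
      by move=> [Ex Bx] i iN; rewrite /E1; case: eqP => // _; exact: Ex.
    move=> Ex; split; last by have := Ex m.+1 mN; rewrite /E1 eqxx.
    move=> i iN; have := Ex i iN; rewrite /E1 /E2; case: eqP => [->|//].
    by rewrite ltnn.
  rewrite h1 ?h2; last 2 first.
  + move=> i /andP[i1 iN]; rewrite /E2; case: ifPn => // im.
    by apply: GE; rewrite i1.
  + move=> i /andP[i1 iN]; rewrite /E1; case: eqP => [->//|_]; case: ifPn => // im.
    by apply: GE; rewrite i1.
  rewrite {2}/E1 eqxx {2}/E2 ltnn probability_setT mule1.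
  rewrite [X in (_ * X)%E]big1_seq ?mule1; last first.
    move=> i /=; rewrite mem_index_iota => /andP[mi iN].
    rewrite /E1 (gtn_eqF mi) ifF ?probability_setT //.
    by apply/negbTE; rewrite -ltnNge (ltn_trans _ mi).
  rewrite [X in (_ * (_ * X))%E]big1_seq ?mule1; last first.
    move=> i /=; rewrite mem_index_iota => /andP[mi iN].
    rewrite /E2 ifF ?probability_setT //.
    by apply/negbTE; rewrite -ltnNge (ltn_trans _ mi).
  rewrite muleC; congr (_ * _)%E; apply: eq_big_nat => i /andP[i1 im].
  by rewrite /E1 /E2 (ltn_eqF im).
- move=> _; rewrite /= /mrestr setTI; apply: le_lt_trans (ltry 1).
  exact: probability_le1.
Qed.

End independence.
Arguments past {d T} G m.

(** * Concentration of sums of independent vectors *)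

(** The quadratic is evaluated at its minimiser [c / b]. For [b = 0] it is affine in [t], which
    forces [c = 0]. *)
Lemma discriminant_le (R : realFieldType) (a b c : R) :
  0 <= b -> (forall t, 0 <= a - 2 * t * c + t ^+ 2 * b) -> c ^+ 2 <= a * b.
Proof.
move=> b_ge0 h; have a0 : 0 <= a by have := h 0; lra.
have [b0|b0] := eqVneq b 0; last first.
  have := h (c / b).
  have -> : a - 2 * (c / b) * c + (c / b) ^+ 2 * b = (a * b - c ^+ 2) / b by field.
  have bp : 0 < b by rewrite lt_neqAle eq_sym b0.
  by rewrite pmulr_lge0 ?invr_gt0 // subr_ge0.
rewrite b0 mulr0; have [->|c0] := eqVneq c 0; first by rewrite expr0n.
(* This [t] gives the affine function the value -1. *)
have := h ((a + 1) / (2 * c)); rewrite b0 mulr0 addr0.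
have -> : a - 2 * ((a + 1) / (2 * c)) * c = -1 by field.
by rewrite ler0N1.
Qed.

Lemma sum_cauchy_schwarz (R : realFieldType) (I : Type) (s : seq I) (a b : I -> R) :
  (\sum_(i <- s) a i * b i) ^+ 2 <=
  (\sum_(i <- s) a i ^+ 2) * (\sum_(i <- s) b i ^+ 2).
Proof.
apply: discriminant_le => [|t].
  by apply: sumr_ge0 => i _; exact: sqr_ge0.
suff -> : \sum_(i <- s) a i ^+ 2 - 2 * t * (\sum_(i <- s) a i * b i) +
    t ^+ 2 * (\sum_(i <- s) b i ^+ 2) = \sum_(i <- s) (a i - t * b i) ^+ 2.
  by apply: sumr_ge0 => i _; exact: sqr_ge0.
by rewrite !mulr_sumr -sumrB -big_split /=; apply: eq_bigr => i _; ring.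
Qed.

Section hilbert_concentration.
Context d (T : measurableType d) (R : realType) (P : probability T R).
Variables (G : nat -> set (set T)) (N k : nat).
Hypothesis Gm : forall i, (1 <= i <= N)%N -> <<s G i >> `<=` measurable.
Hypothesis indep : forall E : nat -> set T,
  (forall i, (1 <= i <= N)%N -> <<s G i >> (E i)) ->
  P (\bigcap_(i in [set i | (1 <= i <= N)%N]) E i) =
  (\prod_(1 <= i < N.+1) P (E i))%E.
Variables (X : nat -> 'I_k -> T -> R) (c : nat -> R).
Hypothesis mX : forall i j, (1 <= i <= N)%N ->
  measurable_fun (setT : set (g_sigma_algebraType (G i))) (X i j).
Hypothesis X0 : forall i j, (1 <= i <= N)%N -> (\int[P]_w (X i j w)%:E = 0)%E.
Hypothesis c0 : forall i, 0 <= c i.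
Hypothesis Xc : forall i w, (1 <= i <= N)%N -> \sum_j X i j w ^+ 2 <= c i ^+ 2.

Definition partial_sum m j w := \sum_(1 <= i < m.+1) X i j w.
Definition sum_norm m w := Num.sqrt (\sum_j partial_sum m j w ^+ 2).
Local Notation S := partial_sum.
Local Notation u := sum_norm.

Lemma partial_sumS m j w : S m.+1 j w = S m j w + X m.+1 j w.
Proof. by rewrite /S big_nat_recr. Qed.

Lemma sum_norm_sqr m w : u m w ^+ 2 = \sum_j S m j w ^+ 2.
Proof. by rewrite sqr_sqrtr // sumr_ge0 // => j _; exact: sqr_ge0. Qed.

Lemma sum_norm_ge0 m w : 0 <= u m w. Proof. exact: sqrtr_ge0. Qed.

Lemma partial_sum_le m j w : `|S m j w| <= u m w.
Proof.
rewrite -(@ler_pXn2r _ 2) ?nnegrE ?sum_norm_ge0 // sum_norm_sqr.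
rewrite real_normK ?num_real // (bigD1 j) //= lerDl.
by apply: sumr_ge0 => i _; exact: sqr_ge0.
Qed.

Let z m w := \sum_j S m j w * X m.+1 j w.

Lemma sum_norm_step m w : (m < N)%N ->
  u m.+1 w ^+ 2 <= u m w ^+ 2 + c m.+1 ^+ 2 + 2 * z m w.
Proof.
move=> mN; rewrite [leLHS]sum_norm_sqr.
under eq_bigr do rewrite partial_sumS sqrrD -mulr_natl.
rewrite !big_split /= -sum_norm_sqr -mulr_sumr -/(z m w).
by have := Xc m.+1 w mN; lra.
Qed.

Lemma inner_le m w : (m < N)%N -> `|z m w| <= u m w * c m.+1.
Proof.
move=> mN; rewrite -(@ler_pXn2r _ 2) ?nnegrE ?mulr_ge0 ?sum_norm_ge0 //.
rewrite real_normK ?num_real // exprMn sum_norm_sqr.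
apply: le_trans (sum_cauchy_schwarz _ _ _ _ _) _.
by apply: ler_wpM2l; [apply: sumr_ge0 => i _; exact: sqr_ge0|exact: Xc].
Qed.

(** The triangle inequality gives a deterministic bound, from which all the integrability claims
    below follow. *)
Lemma sum_norm_le m w : (m <= N)%N -> u m w <= \sum_(1 <= i < m.+1) c i.
Proof.
elim: m => [_|m IH mN].
  rewrite /u big1 ?sqrtr0 ?big_geq // => j _.
  by rewrite /S big_geq // expr0n.
rewrite big_nat_recr //=.
have : u m.+1 w <= u m w + c m.+1.
  rewrite -(@ler_pXn2r _ 2) ?nnegrE ?addr_ge0 ?sum_norm_ge0 //.
  apply: le_trans (sum_norm_step m w mN) _.
  have := inner_le m w mN; rewrite ler_norml => /andP[_ h].
  by rewrite sqrrD; lra.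
by have := IH (ltnW mN); lra.
Qed.

(** The factor of [X m.+1 j] in the cross term [<S, X> sinh |S| / |S|]. It depends on the past only,
    so the cross term can be shown centred coordinate by coordinate. Where [|S| = 0] the inverse is
    0 and [F] vanishes. *)
Let F m j w := S m j w * ((u m w)^-1 * sinh (u m w)).

(** [cosh_cosines] with sides [u m w] and [c m.+1] and with cosine [y], the normalised inner product
    of the past sum and the new increment. *)
Lemma cosh_sum_norm_step m w : (m < N)%N ->
  cosh (u m.+1 w) <= cosh (u m w) * cosh (c m.+1) +
    ((c m.+1)^-1 * sinh (c m.+1)) * \sum_j F m j w * X m.+1 j w.
Proof.
move=> mN; set a := u m w; set b := c m.+1; pose y := z m w / (a * b).
have a0 : 0 <= a by exact: sum_norm_ge0.
have b0 : 0 <= b by exact: c0.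
have zab := inner_le m w mN; rewrite -/a -/b in zab.
have -> : b^-1 * sinh b * (\sum_j F m j w * X m.+1 j w) = y * (sinh a * sinh b).
  have -> : \sum_j F m j w * X m.+1 j w = z m w * (a^-1 * sinh a).
    by rewrite /z mulr_suml; apply: eq_bigr => j _; rewrite /F -/a; ring.
  by rewrite /y invfM; ring.
(* When a side is zero, [inner_le] makes the inner product vanish, and the cosine is then 0. *)
have [ab0|abn0] := eqVneq (a * b) 0.
  have z0 : z m w = 0.
    by move: zab; rewrite ab0 normr_le0 => /eqP.
  apply: cosh_cosines => //; rewrite ?sum_norm_ge0 //.
    by rewrite /y z0 mul0r; apply/andP; split; lra.
  apply: le_trans (sum_norm_step m w mN) _.
  by rewrite -/a -/b /y z0; lra.
have ab : 0 < a * b by rewrite lt_neqAle eq_sym abn0 mulr_ge0.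
apply: cosh_cosines => //; rewrite ?sum_norm_ge0 //.
  by rewrite -ler_norml /y normrM normfV (ger0_norm (ltW ab)) ler_pdivrMr // mul1r.
apply: le_trans (sum_norm_step m w mN) _.
suff -> : 2 * y * a * b = 2 * z m w by [].
by rewrite /y -!mulrA; congr (_ * _); rewrite mulVf // mulr1.
Qed.

(** The length [m'] of the sum is kept apart from [m], so that the induction runs with a fixed
    sigma-algebra. *)
Lemma measurable_past_partial_sum m m' j : (m' <= m)%N -> (m <= N)%N ->
  measurable_fun (setT : set (g_sigma_algebraType (past G m))) (S m' j).
Proof.
elim: m' => [_ _|m' IH mm mN].
  by rewrite (_ : S 0 j = cst 0) //; apply/funext => w; rewrite /S big_geq.
rewrite (_ : S m'.+1 j = S m' j \+ X m'.+1 j); last first.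
  by apply/funext => w; rewrite partial_sumS.
apply: measurable_funD; first by apply: IH => //; exact: ltnW.
apply: (measurable_past _ T R G m m'.+1) => //.
by apply: mX; rewrite /= (leq_trans mm).
Qed.

Lemma measurable_past_sum_norm m : (m <= N)%N ->
  measurable_fun (setT : set (g_sigma_algebraType (past G m))) (u m).
Proof.
move=> mN.
have -> : u m = (@powR R ^~ 2^-1) \o (fun w => \sum_j S m j w ^+ 2).
  apply/funext => w /=; rewrite powR12_sqrt // sumr_ge0 // => j _; exact: sqr_ge0.
apply: measurableT_comp; first exact: measurable_powR.
apply: measurable_sum => j; apply: measurable_funX.
exact: measurable_past_partial_sum.
Qed.

Lemma measurable_cosh : measurable_fun setT (@cosh R).
Proof.
rewrite (_ : @cosh R = (fun x => (expR x + (@expR R \o -%R) x) * 2^-1)) //.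
apply: measurable_funM => //; apply: measurable_funD => //.
exact: measurableT_comp.
Qed.

Lemma measurable_sinh : measurable_fun setT (@sinh R).
Proof.
rewrite (_ : @sinh R = (fun x => (expR x - (@expR R \o -%R) x) * 2^-1)) //.
apply: measurable_funM => //; apply: measurable_funB => //.
exact: measurableT_comp.
Qed.

Lemma measurable_past_F m j : (m <= N)%N ->
  measurable_fun (setT : set (g_sigma_algebraType (past G m))) (F m j).
Proof.
move=> mN; have mu_ := measurable_past_sum_norm m mN.
apply: measurable_funM; first exact: measurable_past_partial_sum.
apply: measurable_funM; last exact: measurableT_comp measurable_sinh mu_.
rewrite (_ : (fun w => _) = (@powR R ^~ (-1)) \o u m).
  by apply: measurableT_comp => //; exact: measurable_powR.
by apply/funext => w /=; rewrite powR_inv1 // sum_norm_ge0.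
Qed.

Lemma past_measurable_fun m (f : T -> R) : (m <= N)%N ->
  measurable_fun (setT : set (g_sigma_algebraType (past G m))) f ->
  measurable_fun setT f.
Proof.
move=> mN mf _ B mB.
have : <<s past G m >> (setT `&` f @^-1` B) by apply: mf => //; exact: measurableT.
apply: smallest_sub; last exact: (past_measurable _ T G N).
exact: sigma_algebra_measurable.
Qed.

Lemma G_measurable_fun i (f : T -> R) : (1 <= i <= N)%N ->
  measurable_fun (setT : set (g_sigma_algebraType (G i))) f ->
  measurable_fun setT f.
Proof.
move=> iN mf _ B mB; apply: (Gm i iN); by apply: mf => //; exact: measurableT.
Qed.

Lemma measurable_sum_norm m : (m <= N)%N -> measurable_fun setT (u m).
Proof.
by move=> mN; apply: (past_measurable_fun m) => //; exact: measurable_past_sum_norm.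
Qed.

Lemma integrable_cosh_sum_norm m : (m <= N)%N ->
  P.-integrable setT (EFin \o (fun w => cosh (u m w))).
Proof.
move=> mN; apply: (@bounded_measurable_integrable _ _ _ _ _
    (cosh (\sum_(1 <= i < m.+1) c i))).
  by apply: (measurableT_comp measurable_cosh); exact: measurable_sum_norm.
move=> w; rewrite ger0_norm ?(ltW (cosh_gt0 _)) //.
by apply: ler_cosh; [exact: sum_norm_ge0|exact: sum_norm_le].
Qed.

(** Each coordinate of the sum is at most its norm, so [F] is bounded by [sinh], which is below
    [cosh]. *)
Lemma F_le m j w : `|F m j w| <= cosh (u m w).
Proof.
have sc : sinh (u m w) <= cosh (u m w).
  by rewrite /sinh /cosh; have := expR_gt0 (- u m w); lra.
have s0 : 0 <= sinh (u m w) by rewrite sinh_ge0 // sum_norm_ge0.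
have [e|n] := eqVneq (u m w) 0.
  by rewrite /F e sinh0 !mulr0 normr0 ltW // cosh_gt0.
have up : 0 < u m w by rewrite lt_neqAle eq_sym n sum_norm_ge0.
rewrite /F normrM [X in _ * X]normrM normfV (ger0_norm (sum_norm_ge0 _ _)) (ger0_norm s0) mulrA.
apply: le_trans sc; rewrite -[leRHS]mul1r; apply: ler_wpM2r => //.
by rewrite ler_pdivrMr // mul1r partial_sum_le.
Qed.

(** [F m j] is measurable with respect to the past and [X m.+1 j] is centred and independent of it;
    both are bounded. *)
Lemma integral_FX0 m j : (m < N)%N ->
  P.-integrable setT (EFin \o (F m j \* X m.+1 j)) /\
  (\int[P]_w (F m j w * X m.+1 j w)%:E = 0)%E.
Proof.
move=> mN.
pose K := cosh (\sum_(1 <= i < m.+1) c i).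
have FK w : `|F m j w| <= K.
  apply: le_trans (F_le _ _ _) _.
  by apply: ler_cosh; [exact: sum_norm_ge0|apply: sum_norm_le; exact: ltnW].
have Xb w : `|X m.+1 j w| <= c m.+1.
  rewrite -(@ler_pXn2r _ 2) ?nnegrE ?c0 // real_normK ?num_real //.
  apply: le_trans (Xc m.+1 w mN); rewrite (bigD1 j) //= lerDl.
  by apply: sumr_ge0 => i _; exact: sqr_ge0.
have mF : measurable_fun setT (F m j).
  by apply: (past_measurable_fun m (F m j) (ltnW mN)); exact: measurable_past_F (ltnW mN).
have mX' : measurable_fun setT (X m.+1 j).
  by apply: (G_measurable_fun m.+1) => //; exact: mX.
have iFX : P.-integrable setT (EFin \o (F m j \* X m.+1 j)).
  apply: (@bounded_measurable_integrable _ _ _ _ _ (K * c m.+1)).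
    exact: measurable_funM.
  by move=> w /=; rewrite normrM; apply: ler_pM.
split => //; apply: independent_integral_mul0 => //.
- exact: bounded_measurable_integrable mF FK.
- exact: bounded_measurable_integrable mX' Xb.
- move=> A B mA mB; apply: (past_indep _ _ _ _ G N Gm indep m) => //.
    have := @measurable_past_F m j (ltnW mN).
    by move=> /(_ measurableT A mA); rewrite setTI.
  by have := mX m.+1 j mN; move=> /(_ measurableT B mB); rewrite setTI.
- exact: X0.
Qed.

(* Pinelis' exponential moment bound: the cross term is centred given the past. *)
Lemma expectation_cosh_sum_norm m : (m <= N)%N ->
  (\int[P]_w (cosh (u m w))%:E <= (\prod_(1 <= i < m.+1) cosh (c i))%:E)%E.
Proof.
elim: m => [_|m IH mN].
  have h w : u 0 w = 0.
    rewrite /u big1 ?sqrtr0 // => j _.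
    by rewrite /S big_geq // expr0n.
  under eq_integral do rewrite h cosh0.
  rewrite big_geq // integral_cst // mul1e.
  exact: probability_le1.
set kap := (c m.+1)^-1 * sinh (c m.+1).
have i1 : P.-integrable setT (fun w => (cosh (c m.+1))%:E * (cosh (u m w))%:E)%E.
  by apply: integrableZl => //; apply: integrable_cosh_sum_norm; exact: ltnW.
have i2 : P.-integrable setT (fun w => \sum_j (F m j w * X m.+1 j w)%:E)%E.
  by apply: integrable_sum => // j _; case: (integral_FX0 m j mN).
have i3 : P.-integrable setT (fun w => kap%:E * \sum_j (F m j w * X m.+1 j w)%:E)%E.
  exact: integrableZl.
(* The one-step inequality is integrated: its first term yields the new factor [cosh (c m.+1)], and
   the second integrates to 0. *)
apply: (@le_trans _ _ (\int[P]_w ((cosh (c m.+1))%:E * (cosh (u m w))%:E +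
    kap%:E * \sum_j (F m j w * X m.+1 j w)%:E))%E).
  apply: le_integral => //.
  - exact: integrable_cosh_sum_norm.
  - exact: integrableD.
  - move=> w _; rewrite /= -EFinM sumEFin -EFinM -EFinD lee_fin mulrC.
    exact: cosh_sum_norm_step.
rewrite integralD // integralZl //; last first.
  by apply: integrable_cosh_sum_norm; exact: ltnW.
rewrite integralZl // integral_sum //; last first.
  by move=> j; case: (integral_FX0 m j mN).
rewrite big1 => [|j _]; last by case: (integral_FX0 m j mN).
rewrite mule0 adde0 big_nat_recr //= mulrC [leRHS]EFinM.
by apply: lee_wpmul2l; [rewrite lee_fin ltW // cosh_gt0|apply: IH; exact: ltnW].
Qed.

End hilbert_concentration.
Arguments partial_sum {d T R k} X m j w.
Arguments sum_norm {d T R k} X m w.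

Lemma sum_normZ d (T : measurableType d) (R : realType) k (X : nat -> 'I_k -> T -> R) (l : R)
    m (w : T) : 0 <= l ->
  sum_norm (fun i j w => l * X i j w) m w = l * sum_norm X m w.
Proof.
move=> l0; rewrite /sum_norm -[in RHS](ger0_norm l0) -sqrtr_sqr -sqrtrM ?sqr_ge0 //.
congr Num.sqrt; rewrite mulr_sumr; apply: eq_bigr => j _.
by rewrite /partial_sum -mulr_sumr exprMn.
Qed.

(** * From the exponential moment to the tail bound *)

Section tail.
Context d (T : measurableType d) (R : realType) (P : probability T R).
Variables (G : nat -> set (set T)) (N k : nat).
Hypothesis Gm : forall i, (1 <= i <= N)%N -> <<s G i >> `<=` measurable.
Hypothesis indep : forall E : nat -> set T,
  (forall i, (1 <= i <= N)%N -> <<s G i >> (E i)) ->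
  P (\bigcap_(i in [set i | (1 <= i <= N)%N]) E i) =
  (\prod_(1 <= i < N.+1) P (E i))%E.
Variables (X : nat -> 'I_k -> T -> R) (c : nat -> R).
Hypothesis mX : forall i j, (1 <= i <= N)%N ->
  measurable_fun (setT : set (g_sigma_algebraType (G i))) (X i j).
Hypothesis X0 : forall i j, (1 <= i <= N)%N -> (\int[P]_w (X i j w)%:E = 0)%E.
Hypothesis c0 : forall i, 0 <= c i.
Hypothesis Xc : forall i w, (1 <= i <= N)%N -> \sum_j X i j w ^+ 2 <= c i ^+ 2.

(** Markov's inequality for [cosh (l |S|)]: its mean is at most [expR (delta ^+ 2 / 2)], while on
    the event it is at least [cosh (delta ^+ 2)]. *)
Lemma sum_norm_tail (delta : R) : 0 < delta ->
  0 < \sum_(1 <= i < N.+1) c i ^+ 2 ->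
  (P [set w | (delta * Num.sqrt (\sum_(1 <= i < N.+1) c i ^+ 2) < sum_norm X N w)%R]
    <= (2 * expR (- (delta ^+ 2) / 2))%:E)%E.
Proof.
move=> d0 B0; set B := \sum_(1 <= i < N.+1) c i ^+ 2.
set r := delta * Num.sqrt B.
have sB : 0 < Num.sqrt B by rewrite sqrtr_gt0.
(* This [l] minimises the exponent [l ^+ 2 * B / 2 - l * r]. *)
pose l := delta / Num.sqrt B.
have l0 : 0 < l by rewrite divr_gt0.
pose X' i (j : 'I_k) w := l * X i j w.
pose c' i := l * c i.
have mX' i j : (1 <= i <= N)%N ->
    measurable_fun (setT : set (g_sigma_algebraType (G i))) (X' i j).
  by move=> iN; apply: measurable_funM => //; exact: mX.
have bd i j w : (1 <= i <= N)%N -> `|X i j w| <= c i.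
  move=> iN; rewrite -(@ler_pXn2r _ 2) ?nnegrE ?c0 // real_normK ?num_real //.
  apply: le_trans (Xc i w iN); rewrite (bigD1 j) //= lerDl.
  by apply: sumr_ge0 => ? _; exact: sqr_ge0.
have X'0 i j : (1 <= i <= N)%N -> (\int[P]_w (X' i j w)%:E = 0)%E.
  move=> iN; under eq_integral do rewrite EFinM.
  rewrite integralZl //; first by rewrite X0 // mule0.
  apply: (@bounded_measurable_integrable _ _ _ _ _ (c i)); last by move=> w; exact: bd.
  by apply: (G_measurable_fun _ T R G N Gm i) => //; exact: mX.
have c'0 i : 0 <= c' i by rewrite mulr_ge0 // ltW.
have X'c i w : (1 <= i <= N)%N -> \sum_j X' i j w ^+ 2 <= c' i ^+ 2.
  move=> iN; rewrite /X' /c' exprMn; under eq_bigr do rewrite exprMn.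
  by rewrite -mulr_sumr; apply: ler_wpM2l; [exact: sqr_ge0|exact: Xc].
have := expectation_cosh_sum_norm _ T R P G N k Gm indep X' c' mX' X'0 c'0 X'c N (leqnn N).
set I := (\int[P]_w _)%E => IE.
have prodle : \prod_(1 <= i < N.+1) cosh (c' i) <= expR (delta ^+ 2 / 2).
  have -> : expR (delta ^+ 2 / 2) = \prod_(1 <= i < N.+1) expR (c' i ^+ 2 / 2).
    rewrite -expR_sum; congr expR; rewrite -mulr_suml; congr (_ / _).
    rewrite /c'; under eq_bigr do rewrite exprMn.
    rewrite -mulr_sumr -/B /l expr_div_n sqr_sqrtr ?ltW //.
    by rewrite divfK // gt_eqF.
  apply: ler_prod => i _; rewrite cosh_le_expR andbT ltW //; exact: cosh_gt0.
set A := [set w | _].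
have mu_ := measurable_sum_norm _ T R G N k Gm X mX N (leqnn N).
have mA : measurable A.
  have := measurable_fun_ltr (measurable_cst r) mu_.
  move=> /(_ measurableT [set true]) /= /(_ Logic.I); rewrite setTI.
  by congr measurable; apply/seteqP; split.
have PA : ((cosh (delta ^+ 2))%:E * P A <= I)%E.
  have ic := integrable_cosh_sum_norm _ T R P G N k Gm X' c' mX' c'0 X'c N (leqnn N).
  have mc : measurable_fun setT (fun w => (cosh (sum_norm X' N w))%:E).
    exact: measurable_int ic.
  rewrite -integral_cst //.
  apply: (@le_trans _ _ (\int[P]_(w in A) (cosh (sum_norm X' N w))%:E)%E).
    apply: ge0_le_integral => //.
    - by move=> w _; rewrite lee_fin ltW // cosh_gt0.
    - exact: measurable_funTS.
    - move=> w Aw; rewrite lee_fin; apply: ler_cosh; first exact: sqr_ge0.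
      rewrite sum_normZ ?(ltW l0) //.
      have -> : delta ^+ 2 = l * r.
        by rewrite /l /r mulrACA mulVf ?mulr1 -?expr2 // gt_eqF.
      by apply: ler_wpM2l; [exact: ltW|exact: ltW].
  apply: ge0_subset_integral => //.
  by move=> w _; rewrite lee_fin ltW // cosh_gt0.
(* The constant 2 of the conclusion comes from this lower bound on [cosh]. *)
have cge : expR (delta ^+ 2) / 2 <= cosh (delta ^+ 2).
  by rewrite /cosh; have := expR_gt0 (- delta ^+ 2); lra.
have PAfin : P A \is a fin_num by rewrite fin_num_measure.
rewrite -(fineK PAfin) in PA *.
have {IE} := le_trans PA IE; rewrite -EFinM !lee_fin => h.
have p0 : 0 <= fine (P A) by rewrite fine_ge0.
have h1 : expR (delta ^+ 2) / 2 * fine (P A) <= expR (delta ^+ 2 / 2).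
  by apply: le_trans prodle; apply: le_trans h; apply: ler_wpM2r.
have e1 : expR (delta ^+ 2) = expR (delta ^+ 2 / 2) * expR (delta ^+ 2 / 2).
  by rewrite -expRD; congr expR; field.
rewrite mulNr expRN.
have ep := expR_gt0 (delta ^+ 2 / 2); set e := expR (delta ^+ 2 / 2) in e1 h1 ep *.
rewrite ler_pdivlMr // -(ler_pM2l ep).
by rewrite e1 in h1; lra.
Qed.

End tail.

(** * The space [L^2(D, mu)] *)

Section integral_ae.
Context d (T : measurableType d) (R : realType) (mu : {measure set T -> \bar R}).
Import HBNNSimple.

Lemma ae_imp (p q : T -> Prop) : (forall x, p x -> q x) ->
  {ae mu, forall x, p x} -> {ae mu, forall x, q x}.
Proof. by move=> pq; apply: filterS. Qed.

Lemma ae_imp2 (p q r : T -> Prop) : (forall x, p x -> q x -> r x) ->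
  {ae mu, forall x, p x} -> {ae mu, forall x, q x} -> {ae mu, forall x, r x}.
Proof. by move=> pqr; apply: filterS2. Qed.

(* No measurability: a simple minorant may be set to 0 on the exceptional null set. *)
Lemma ge0_le_integral_ae (D : set T) (f g : T -> \bar R) : measurable D ->
  (forall x, D x -> 0 <= f x)%E -> (forall x, D x -> 0 <= g x)%E ->
  {ae mu, forall x, D x -> (f x <= g x)%E} ->
  (\int[mu]_(x in D) f x <= \int[mu]_(x in D) g x)%E.
Proof.
move=> mD f0 g0 [A [mA A0 fgA]].
rewrite !ge0_integralE //; apply: ge_ereal_sup => _ [h /= hf <-].
have mAC : measurable (~` A) by exact: measurableC.
have -> : sintegral mu h = sintegral mu (proj_nnsfun h mAC).
  rewrite -mrestrict -integral_nnsfun // -integralT_nnsfun.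
  rewrite (ge0_negligible_integral mA) ?setTD //.
  - by apply/measurable_EFinP; exact: measurable_funTS.
  - by move=> x _; rewrite lee_fin fun_ge0.
apply: ereal_sup_ubound; exists (proj_nnsfun h mAC) => // x.
have := hf x; rewrite /= mindicE /patch; case: ifPn => xD; last first.
  move=> hx0; have : h x = 0 by apply/eqP; rewrite eq_le fun_ge0 andbT -lee_fin.
  by move=> ->; rewrite mul0r.
move=> hx; have [xA|xA] := boolP (x \in ~` A).
  rewrite mulr1; apply: le_trans hx _.
  move: xA xD; rewrite !inE => xA xD.
  by apply: contrapT => nfg; apply: xA; apply: fgA => /=; tauto.
by rewrite mulr0; apply: g0; move: xD; rewrite inE.
Qed.

(** Positive and negative parts are compared separately, by two inequalities each. This lets [ipH]
    and [normH] act on almost-everywhere classes even when a representative, such as [YNT i w], may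
    fail to be measurable. *)
Lemma ae_eq_integral_nonmeasurable (D : set T) (f g : T -> \bar R) :
  measurable D -> f = g %[ae mu in D] ->
  (\int[mu]_(x in D) f x = \int[mu]_(x in D) g x)%E.
Proof.
move=> mD.
have key (f1 g1 : T -> \bar R) : (forall x, 0 <= f1 x)%E -> (forall x, 0 <= g1 x)%E ->
    f1 = g1 %[ae mu in D] ->
    (\int[mu]_(x in D) f1 x = \int[mu]_(x in D) g1 x)%E.
  move=> f0 g0 fg; apply/eqP; rewrite eq_le; apply/andP; split.
    apply: ge0_le_integral_ae => //; apply: filterS fg => x /= h Dx.
    by rewrite h.
  apply: ge0_le_integral_ae => //; apply: filterS fg => x /= h Dx.
  by rewrite h.
move=> /ae_eq_funeposneg[fgp fgn].
by rewrite integralE [RHS]integralE (key _ _ _ _ fgp) // (key _ _ _ _ fgn).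
Qed.

End integral_ae.

Set Implicit Arguments.
Unset Strict Implicit.

Section L2.
Context {R : realType} (D : set R) (mu : {measure set (measurableTypeR R) -> \bar R}).
Hypothesis mD : measurable D.
Local Notation ip := (ipH D mu).
Local Notation nm := (normH D mu).
Local Notation inL2 := (inH D mu).
Local Notation eqL2 := (eqH D mu).
Implicit Types f g h : R -> R.

Lemma eqH_refl f : eqL2 f f.
Proof. exact: ae_eq_refl. Qed.

Lemma eqH_sym f g : eqL2 f g -> eqL2 g f.
Proof. exact: ae_eq_sym. Qed.

Lemma eqH_trans f g h : eqL2 f g -> eqL2 g h -> eqL2 f h.
Proof. exact: ae_eq_trans. Qed.

Lemma eqHB f f' g g' : eqL2 f f' -> eqL2 g g' -> eqL2 (f \- g) (f' \- g').
Proof. by move=> ff' gg'; apply: (ae_imp2 _ _ _ _ _ _ _ _ ff' gg') => x /= h1 h2 Dx; rewrite h1 ?h2. Qed.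

Lemma eqH_sum (I : eqType) (s : seq I) (a : I -> R) (F F' : I -> R -> R) :
  (forall i, i \in s -> eqL2 (F i) (F' i)) ->
  eqL2 (fun x => \sum_(i <- s) a i * F i x) (fun x => \sum_(i <- s) a i * F' i x).
Proof.
elim: s => [_|i s IH FF'].
  rewrite (_ : (fun x => _) = cst 0); last by apply/funext => x; rewrite big_nil.
  rewrite (_ : (fun x => \sum_(i <- [::]) a i * F' i x) = cst 0); last by apply/funext => x; rewrite big_nil.
  exact: eqH_refl.
have h1 := FF' i (mem_head _ _).
have h2 : eqL2 _ _ := IH (fun k ks => FF' k (mem_behead (s := i :: s) ks)).
apply: (ae_imp2 _ _ _ _ _ _ _ _ h1 h2) => x /= e1 e2 Dx.
by rewrite !big_cons e1 // e2.
Qed.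

Lemma ipH_eqH f f' g g' : eqL2 f f' -> eqL2 g g' -> ip f g = ip f' g'.
Proof.
move=> ff' gg'; congr fine; apply: ae_eq_integral_nonmeasurable => //.
by apply: (ae_imp2 _ _ _ _ _ _ _ _ ff' gg') => x /= h1 h2 Dx; rewrite h1 ?h2.
Qed.

Lemma normH_eqH f f' : eqL2 f f' -> nm f = nm f'.
Proof.
move=> ff'; congr (Num.sqrt (fine _)); apply: ae_eq_integral_nonmeasurable => //.
by apply: (ae_imp _ _ _ _ _ _ _ ff') => x /= h1 Dx; rewrite h1.
Qed.

Lemma inH_integrable_sqr f : inL2 f -> mu.-integrable D (EFin \o (fun x => f x ^+ 2)).
Proof.
move=> [mf f2]; apply/integrableP; split.
  by apply/measurable_EFinP; exact: measurable_funX.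
by under eq_integral do rewrite /= ger0_norm ?sqr_ge0 //.
Qed.

(** The product is dominated by [f ^+ 2 + g ^+ 2]. *)
Lemma inH_integrable_mul f g : inL2 f -> inL2 g ->
  mu.-integrable D (EFin \o (f \* g)).
Proof.
move=> Hf Hg.
have i := @integrableD _ _ _ mu D mD _ _ (inH_integrable_sqr Hf) (inH_integrable_sqr Hg).
apply: (@le_integrable _ _ _ mu D mD _ _ _ _ i).
  by apply/measurable_EFinP; apply: measurable_funM; [case: Hf|case: Hg].
move=> x _; rewrite /= lee_fin [leRHS]ger0_norm ?addr_ge0 ?sqr_ge0 //.
rewrite ler_norml; have := sqr_ge0 (f x + g x); have := sqr_ge0 (f x - g x).
have := sqr_ge0 (f x); have := sqr_ge0 (g x); rewrite !expr2 => h1 h2 h3 h4.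
by apply/andP; split; lra.
Qed.

Lemma inH_scale a f : inL2 f -> inL2 (fun x => a * f x).
Proof.
move=> Hf; split; first by apply: measurable_funM => //; case: Hf.
under eq_integral do rewrite exprMn EFinM.
have i := inH_integrable_sqr Hf.
rewrite integralZl //.
by rewrite ltey_eq fin_numM //; exact: integrable_fin_num.
Qed.

Lemma inHD f g : inL2 f -> inL2 g -> inL2 (f \+ g).
Proof.
move=> Hf Hg; split; first by apply: measurable_funD; [case: Hf|case: Hg].
(* The dominating function is [(2 f) ^+ 2 + (2 g) ^+ 2], which exceeds [(f + g) ^+ 2]. *)
have i := @integrableD _ _ _ mu D mD _ _
  (inH_integrable_sqr (inH_scale 2 Hf)) (inH_integrable_sqr (inH_scale 2 Hg)).
have : mu.-integrable D (EFin \o (fun x => (f x + g x) ^+ 2)).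
  apply: (@le_integrable _ _ _ mu D mD _ _ _ _ i).
    apply/measurable_EFinP; apply: measurable_funX.
    by apply: measurable_funD; [case: Hf|case: Hg].
  move=> x _; rewrite /= lee_fin !ger0_norm ?addr_ge0 ?sqr_ge0 //.
  have := sqr_ge0 (f x - g x); have := sqr_ge0 (f x); have := sqr_ge0 (g x).
  by rewrite !expr2 => h1 h2 h3; lra.
move=> /integrableP[_]; by under eq_integral do rewrite /= ger0_norm ?sqr_ge0 //.
Qed.

Lemma inHB f g : inL2 f -> inL2 g -> inL2 (f \- g).
Proof.
move=> Hf Hg; have := inHD Hf (inH_scale (-1) Hg).
by congr inL2; apply/funext => x /=; rewrite mulN1r.
Qed.

Lemma inH0 : inL2 (cst 0).
Proof.
split => //; rewrite integral0_eq // => x _; by rewrite /= expr0n.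
Qed.

Lemma inH_sum (I : eqType) (s : seq I) (a : I -> R) (F : I -> R -> R) :
  (forall i, i \in s -> inL2 (F i)) -> inL2 (fun x => \sum_(i <- s) a i * F i x).
Proof.
elim: s => [_|i s IH HF].
  by rewrite (_ : (fun x => _) = cst 0); [exact: inH0|apply/funext => x; rewrite big_nil].
have h1 := inH_scale (a i) (HF i (mem_head _ _)).
have h2 := IH (fun k ks => HF k (mem_behead (s := i :: s) ks)).
have := inHD h1 h2; congr inL2; apply/funext => x /=; by rewrite big_cons.
Qed.

Lemma ipHC f g : ip f g = ip g f.
Proof. by congr fine; apply: eq_integral => x _; rewrite mulrC. Qed.

Lemma ipHDl f g h : inL2 f -> inL2 g -> inL2 h -> ip (f \+ g) h = ip f h + ip g h.
Proof.
move=> Hf Hg Hh; rewrite -[RHS](@RintegralD _ _ _ mu) //; last 2 first.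
- exact: inH_integrable_mul.
- exact: inH_integrable_mul.
by congr fine; apply: eq_integral => x _; rewrite /= mulrDl.
Qed.

Lemma ipHZl a f h : inL2 f -> inL2 h -> ip (fun x => a * f x) h = a * ip f h.
Proof.
move=> Hf Hh; rewrite -[RHS](@RintegralZl _ _ _ mu) //; last first.
  exact: inH_integrable_mul.
by congr fine; apply: eq_integral => x _; rewrite /= mulrA.
Qed.

Lemma ipHBl f g h : inL2 f -> inL2 g -> inL2 h -> ip (f \- g) h = ip f h - ip g h.
Proof.
move=> Hf Hg Hh.
rewrite (_ : f \- g = f \+ (fun x => -1 * g x)); last first.
  by apply/funext => x /=; rewrite mulN1r.
by rewrite ipHDl ?ipHZl ?mulN1r //; exact: inH_scale.
Qed.

Lemma ipH_suml (I : eqType) (s : seq I) (a : I -> R) (F : I -> R -> R) h :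
  inL2 h -> (forall i, i \in s -> inL2 (F i)) ->
  ip (fun x => \sum_(i <- s) a i * F i x) h = \sum_(i <- s) a i * ip (F i) h.
Proof.
move=> Hh; elim: s => [_|i s IH HF].
  rewrite big_nil /ipH integral0_eq // => x _; by rewrite big_nil mul0r.
have h1 := HF i (mem_head _ _).
have h2 k : k \in s -> inL2 (F k) by move=> ks; apply: HF; rewrite inE ks orbT.
rewrite big_cons -IH // -ipHZl // -ipHDl //; last 2 first.
- exact: inH_scale.
- exact: inH_sum.
by congr fine; apply: eq_integral => x _; rewrite /= big_cons.
Qed.

Lemma ipH_ge0 f : 0 <= ip f f.
Proof. by rewrite fine_ge0 // integral_ge0 // => x _; rewrite lee_fin -expr2 sqr_ge0. Qed.

Lemma normH_sqr f : nm f ^+ 2 = ip f f.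
Proof.
rewrite /normH (_ : (\int[mu]_(x in D) (f x ^+ 2)%:E = \int[mu]_(x in D) (f x * f x)%:E)%E).
  by rewrite sqr_sqrtr //; exact: ipH_ge0.
by apply: eq_integral => x _; rewrite expr2.
Qed.

Lemma normH_ge0 f : 0 <= nm f.
Proof. exact: sqrtr_ge0. Qed.

Lemma normH_sqrD f g : inL2 f -> inL2 g ->
  nm (f \+ g) ^+ 2 = nm f ^+ 2 + 2 * ip f g + nm g ^+ 2.
Proof.
move=> Hf Hg; rewrite !normH_sqr; have Hfg := inHD Hf Hg.
rewrite ipHDl // ipHC ipHDl // [ip g (f \+ g)]ipHC ipHDl // [ip g f]ipHC; ring.
Qed.

Lemma normH_scale a f : inL2 f -> nm (fun x => a * f x) ^+ 2 = a ^+ 2 * nm f ^+ 2.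
Proof.
move=> Hf; have Haf := inH_scale a Hf.
by rewrite !normH_sqr ipHZl // ipHC ipHZl // mulrA expr2.
Qed.

Lemma ipH_cauchy_schwarz f g : inL2 f -> inL2 g -> `|ip f g| <= nm f * nm g.
Proof.
move=> Hf Hg; rewrite -(@ler_pXn2r _ 2) ?nnegrE ?mulr_ge0 ?normH_ge0 //.
rewrite real_normK ?num_real // exprMn.
apply: discriminant_le => [|t]; first exact: sqr_ge0.
have := sqr_ge0 (nm (f \+ (fun x => - t * g x))).
rewrite normH_sqrD ?normH_scale //; last exact: inH_scale.
by rewrite ipHC ipHZl // [ip g f]ipHC; lra.
Qed.

Lemma normH_triangle f g : inL2 f -> inL2 g -> nm (f \+ g) <= nm f + nm g.
Proof.
move=> Hf Hg; rewrite -(@ler_pXn2r _ 2) ?nnegrE ?addr_ge0 ?normH_ge0 //.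
rewrite normH_sqrD // sqrrD -mulr_natl.
have := ipH_cauchy_schwarz Hf Hg; rewrite ler_norml => /andP[_ h].
by have := normH_ge0 f; have := normH_ge0 g; lra.
Qed.

(** Minimality of [q] along the segment towards [p] gives the variational inequality
    [0 <= <q - v, p - q>]. Expanding [|p - v|^2] around [q] then leaves at least [|p - q|^2]. *)
Lemma normH_projection_le p q v : inL2 p -> inL2 q -> inL2 v ->
  (forall l, 0 <= l <= 1 ->
     nm (q \- v) <= nm ((fun x => l * p x + (1 - l) * q x) \- v)) ->
  nm (p \- q) <= nm (p \- v).
Proof.
move=> Hp Hq Hv opt.
have Hqv := inHB Hq Hv; have Hpq := inHB Hp Hq.
set e := q \- v in opt Hqv; set f := p \- q in Hpq *.
have E : p \- v = e \+ f by apply/funext => x /=; rewrite /e /f /=; ring.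
suff ef0 : 0 <= ip e f.
  rewrite -(@ler_pXn2r _ 2) ?nnegrE ?normH_ge0 // E [leRHS]normH_sqrD //.
  by rewrite lerDr addr_ge0 ?sqr_ge0 ?mulr_ge0 //.
have key l : 0 <= l <= 1 -> 0 <= 2 * l * ip e f + l ^+ 2 * nm f ^+ 2.
  move=> l01; have := opt l l01.
  rewrite -(@ler_pXn2r _ 2) ?nnegrE ?normH_ge0 //.
  rewrite (_ : _ \- v = e \+ (fun x => l * f x)); last first.
    by apply/funext => x /=; rewrite /e /f /=; ring.
  rewrite [leRHS]normH_sqrD ?normH_scale //; last exact: inH_scale.
  by rewrite ipHC ipHZl // [ip f e]ipHC; lra.
rewrite leNgt; apply/negP => s0.
set s := - ip e f; have sp : 0 < s by rewrite oppr_gt0.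
set F := nm f ^+ 2 in key; have F0 : 0 <= F by exact: sqr_ge0.
have Fs : 0 < F + s by lra.
(* Close to the minimiser [s / F], but inside [[0, 1]] and defined for [F = 0] as well; the
   quadratic is negative there. *)
have := key (s / (F + s)).
have -> : 0 <= s / (F + s) <= 1.
  apply/andP; split; first by rewrite divr_ge0 ?ltW.
  by rewrite ler_pdivrMr // mul1r; lra.
move=> /(_ isT).
have -> : ip e f = - s by rewrite opprK.
have -> : 2 * (s / (F + s)) * - s + (s / (F + s)) ^+ 2 * F =
  - (s ^+ 2 / (F + s)) * (1 + s / (F + s)) by field; rewrite gt_eqF.
rewrite leNgt nmulr_rlt0; last by rewrite oppr_lt0 divr_gt0 // exprn_gt0.
by rewrite ltr_wpDr // divr_ge0 // ltW.
Qed.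

End L2.

(** * Integral operators with square-integrable kernels *)

Section integral_operator.
Context {R : realType} (D : set R) (mu : {measure set (measurableTypeR R) -> \bar R}).
Hypothesis mD : measurable D.
Hypothesis muD : (mu D < +oo)%E.

(** Extended-real valued, since a section of a square-integrable kernel may have infinite norm on a
    null set. *)
Definition section_sqr (beta : R * R -> R) (x : R) : \bar R :=
  \int[mu]_(y in D) ((beta (x, y)) ^+ 2)%:E.

Lemma section_sqr_ge0 beta x : (0 <= section_sqr beta x)%E.
Proof. by apply: integral_ge0 => y _; rewrite lee_fin sqr_ge0. Qed.

Lemma measurable_patch_prod (beta : R * R -> R) :
  measurable_fun (D `*` D) beta -> measurable_fun setT (beta \_ (D `*` D)).
Proof.
move=> mb; apply: (measurable_restrictT _ _).1 => //.
exact: measurableX.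
Qed.

(** Tonelli's theorem, for [beta] extended by 0 outside the square of [D] and [mu] restricted to
    [D], which is a finite measure. *)
Lemma measurable_section_sqr (beta : R * R -> R) :
  measurable_fun (D `*` D) beta -> measurable_fun D (section_sqr beta).
Proof.
move=> /measurable_patch_prod mb.
pose nu : {finite_measure set (measurableTypeR R) -> \bar R} := @mfrestr _ (measurableTypeR R) R D mu mD muD.
pose bt z := (((beta \_ (D `*` D)) z) ^+ 2)%:E.
have mbt : measurable_fun setT bt.
  by apply/measurable_EFinP; exact: measurable_funX.
have bt0 z : (0 <= bt z)%E by rewrite lee_fin sqr_ge0.
have := @measurable_fun_fubini_tonelli_F _ _ (measurableTypeR R) (measurableTypeR R) R nu bt mbt bt0.
move=> /(measurable_funS measurableT (@subsetT _ D)).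
apply: eq_measurable_fun => x xD.
rewrite /fubini_F /section_sqr.
rewrite (_ : \int[nu]_y bt (x, y) = \int[nu]_(y in D) ((beta (x, y)) ^+ 2)%:E)%E.
  apply: eq_measure_integral => A mA AD.
  by rewrite /= /mfrestr /mrestr setIidl.
rewrite [RHS]integral_mkcond; apply: eq_integral => y _.
rewrite /bt !patchE in_setX xD /=.
by case: ifP => //; rewrite expr0n.
Qed.

(** An integrable function is finite almost everywhere; here it is the squared norm of the
    section. *)
Lemma ae_section_inH (beta : R * R -> R) : inHH D mu beta ->
  {ae mu, forall x, D x -> inH D mu (fun y => beta (x, y))}.
Proof.
move=> [mb bfin].
have i : mu.-integrable D (section_sqr beta).
  apply/integrableP; split; first exact: measurable_section_sqr.
  by under eq_integral do rewrite gee0_abs ?section_sqr_ge0 //.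
have := @integrable_ae _ (measurableTypeR R) R mu D mD _ i.
apply: ae_imp => x h Dx; split; last by have := h Dx; rewrite ge0_fin_numE ?section_sqr_ge0.
apply/measurable_restrictT => //.
have /measurable_patch_prod mb' := mb.
have := @measurableT_comp _ _ _ _ _ _ _ _ _ mb'
  (@pair1_measurable _ _ (measurableTypeR R) (measurableTypeR R) x).
apply: eq_measurable_fun => y _ /=.
by rewrite !patchE in_setX (mem_set Dx).
Qed.

Lemma normHH_sqr beta : normHH D mu beta ^+ 2 = fine (\int[mu]_(x in D) section_sqr beta x).
Proof.
by rewrite sqr_sqrtr // fine_ge0 // integral_ge0 // => x _; exact: section_sqr_ge0.
Qed.

(* Hilbert-Schmidt bound, by Cauchy-Schwarz in the inner integral and in the sum. *)
Lemma normH_integral_operator_le (T0 : nat) (beta : nat -> R * R -> R) (U : nat -> R -> R) :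
  (forall t, (1 <= t <= T0)%N -> inHH D mu (beta t)) ->
  (forall t, (1 <= t <= T0)%N -> inH D mu (U t)) ->
  normH D mu (fun x => \sum_(1 <= t < T0.+1) ipH D mu (fun y => beta t (x, y)) (U t)) <=
  Num.sqrt (\sum_(1 <= t < T0.+1) normHH D mu (beta t) ^+ 2) *
  Num.sqrt (\sum_(1 <= t < T0.+1) normH D mu (U t) ^+ 2).
Proof.
move=> Hb HU; set B := \sum_(_ <= _ < _) normHH _ _ _ ^+ 2.
set C := \sum_(_ <= _ < _) normH _ _ _ ^+ 2.
have B0 : 0 <= B by apply: sumr_ge0 => t _; exact: sqr_ge0.
have C0 : 0 <= C by apply: sumr_ge0 => t _; exact: sqr_ge0.
(* The value 0 outside the range gives measurability and nonnegativity for every index. *)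
pose b t := if (1 <= t <= T0)%N then section_sqr (beta t) else cst 0%E.
have b0 t x : (0 <= b t x)%E by rewrite /b; case: ifP => // _; exact: section_sqr_ge0.
have mb t : measurable_fun D (b t).
  rewrite /b; case: ifP => // /Hb[m _]; exact: measurable_section_sqr.
have bB : (\sum_(1 <= t < T0.+1) \int[mu]_(x in D) b t x = B%:E)%E.
  rewrite /B -sumEFin; apply: eq_big_nat => t tT.
  rewrite normHH_sqr fineK; first by rewrite /b tT.
  rewrite ge0_fin_numE; first by case: (Hb t tT).
  by apply: integral_ge0 => x _; exact: section_sqr_ge0.
have key : (\int[mu]_(x in D) ((\sum_(1 <= t < T0.+1)
    ipH D mu (fun y => beta t (x, y)) (U t)) ^+ 2)%:E <= (B * C)%:E)%E.
  apply: (@le_trans _ _ (\int[mu]_(x in D) (C%:E * \sum_(1 <= t < T0.+1) b t x))%E).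
    apply: ge0_le_integral_ae => //.
    - by move=> x _; rewrite lee_fin sqr_ge0.
    - by move=> x _; rewrite mule_ge0 ?lee_fin // sume_ge0.
    have : {ae mu, forall x, forall t, (1 <= t <= T0)%N -> D x ->
        inH D mu (fun y => beta t (x, y))}.
      apply: ae_foralln => t; have [tT|tT] := boolP (1 <= t <= T0)%N; last exact: aeW.
      by apply: ae_imp (ae_section_inH (Hb t tT)).
    apply: ae_imp => x hx Dx.
    have -> : (\sum_(1 <= t < T0.+1) b t x =
        (\sum_(1 <= t < T0.+1) normH D mu (fun y => beta t (x, y)) ^+ 2)%:E)%E.
      rewrite -sumEFin; apply: eq_big_nat => t tT.
      rewrite /b tT /normH sqr_sqrtr ?fineK //.
        by rewrite ge0_fin_numE ?section_sqr_ge0 //; case: (hx t tT Dx).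
      by rewrite fine_ge0 // section_sqr_ge0.
    rewrite -EFinM lee_fin mulrC.
    apply: le_trans (sum_cauchy_schwarz _ _ _ _ _).
    rewrite -[leLHS]real_normK ?num_real // -[leRHS]real_normK ?num_real //.
    rewrite ler_pXn2r ?nnegrE //.
    apply: le_trans (ler_norm_sum _ _ _) _; apply: le_trans (ler_norm _).
    rewrite !big_nat; apply: ler_sum => t tT.
    by apply: ipH_cauchy_schwarz => //; [exact: hx|exact: HU].
  rewrite ge0_integralZl //; last 2 first.
  - exact: emeasurable_sum.
  - by move=> x _; apply: sume_ge0.
  by rewrite ge0_integral_sum // bB -EFinM mulrC.
rewrite -sqrtrM // /normH ler_sqrt ?mulr_ge0 // -lee_fin fineK //.
rewrite ge0_fin_numE; first exact: le_lt_trans key (ltry _).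
by apply: integral_ge0 => x _; rewrite lee_fin sqr_ge0.
Qed.

End integral_operator.

(** * Finite-dimensional approximation *)

Section orthonormal.
Context {R : realType} (D : set R) (mu : {measure set (measurableTypeR R) -> \bar R}).
Hypothesis mD : measurable D.
Local Notation ip := (ipH D mu).
Local Notation nm := (normH D mu).

Definition orthonormal k (phi : 'I_k -> R -> R) :=
  (forall j, inH D mu (phi j)) /\ (forall i j, ip (phi i) (phi j) = (i == j)%:R).

Definition expansion k (phi : 'I_k -> R -> R) (f : R -> R) : R -> R :=
  fun x => \sum_j ip f (phi j) * phi j x.

Lemma inH_expansion k (phi : 'I_k -> R -> R) f : orthonormal phi ->
  inH D mu (expansion phi f).
Proof. by move=> [Hphi _]; apply: inH_sum => // j _. Qed.

Lemma ip_expansion k (phi : 'I_k -> R -> R) f g : orthonormal phi -> inH D mu g ->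
  ip (expansion phi f) g = \sum_j ip f (phi j) * ip g (phi j).
Proof.
move=> [Hphi _] Hg; rewrite /expansion ipH_suml //.
by apply: eq_bigr => j _; rewrite [ip g _]ipHC.
Qed.

Lemma normH_expansion k (phi : 'I_k -> R -> R) f : orthonormal phi ->
  nm (expansion phi f) ^+ 2 = \sum_j ip f (phi j) ^+ 2.
Proof.
move=> on; rewrite normH_sqr ip_expansion //; last exact: inH_expansion.
apply: eq_bigr => j _; rewrite expr2; congr (_ * _).
rewrite ip_expansion //; last by case: on.
rewrite (bigD1 j) //= big1 ?addr0 => [|i ij]; last first.
  by case: on => _ ->; rewrite eq_sym (negbTE ij) mulr0.
by case: on => _ ->; rewrite eqxx mulr1.
Qed.

(** The squared norm of [f] minus its expansion is nonnegative. *)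
Lemma bessel k (phi : 'I_k -> R -> R) f : orthonormal phi -> inH D mu f ->
  \sum_j ip f (phi j) ^+ 2 <= nm f ^+ 2.
Proof.
move=> on Hf; have He := inH_expansion f on.
have := sqr_ge0 (nm (f \+ (fun x => -1 * expansion phi f x))).
rewrite normH_sqrD ?normH_scale ?normH_expansion //; last exact: inH_scale.
rewrite ipHC ipHZl // ip_expansion //.
under eq_bigr do rewrite -expr2.
by lra.
Qed.

Lemma normH_le_of_expansion_cvg (K : nat -> nat) (phi : forall n, 'I_(K n) -> R -> R)
    (f : R -> R) (r : R) : (forall n, orthonormal (phi n)) -> inH D mu f ->
  {ae mu, forall x, D x -> expansion (phi n) f x @[n --> \oo] --> f x} -> 0 <= r ->
  (forall m, exists2 n, (m <= n)%N & \sum_j ip f (phi n j) ^+ 2 <= r ^+ 2) ->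
  nm f <= r.
Proof.
move=> on Hf cvg r0 often.
pose s n x := ((expansion (phi n) f x) ^+ 2)%:E.
have ms n : measurable_fun D (s n).
  by apply/measurable_EFinP; apply: measurable_funX; case: (inH_expansion f (on n)).
have s0 n x : D x -> (0 <= s n x)%E by move=> _; rewrite lee_fin sqr_ge0.
have := fatou mu mD ms s0.
rewrite (_ : \int[mu]_(x in D) limn_einf (s ^~ x) = \int[mu]_(x in D) (f x ^+ 2)%:E)%E; last first.
  apply: ae_eq_integral_nonmeasurable => //.
  apply: ae_imp cvg => x h Dx; apply: (cvg_limn_einf_sup _).1.
  apply: cvg_EFin; first exact: nearW.
  have := h Dx => h'; exact: (cvgM h' h').
(* The lower limit is the limit of the infima over tails, and every tail contains an index at which
   the bound holds. *)
have lim_le : (limn_einf (fun n => \int[mu]_(x in D) s n x) <= (r ^+ 2)%:E)%E.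
  rewrite limn_einf_lim; apply: lime_le; first exact: is_cvg_einfs.
  apply: nearW => m; have [n mn hn] := often m.
  apply: (@le_trans _ _ (\int[mu]_(x in D) s n x)%E).
    by apply: ereal_inf_lbound; exists n.
  have fin : (\int[mu]_(x in D) s n x)%E \is a fin_num.
    rewrite ge0_fin_numE; first by case: (inH_expansion f (on n)).
    by apply: integral_ge0 => x; exact: s0.
  rewrite -(fineK fin) lee_fin; apply: le_trans hn.
  rewrite -normH_expansion // /normH sqr_sqrtr // fine_ge0 //.
  by apply: integral_ge0 => x; exact: s0.
move=> /le_trans/(_ lim_le) h.
rewrite -(@ler_pXn2r _ 2) ?nnegrE ?normH_ge0 //.
have i0 : (0 <= \int[mu]_(x in D) (f x ^+ 2)%:E)%E.
  by apply: integral_ge0 => x _; rewrite lee_fin sqr_ge0.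
rewrite /normH sqr_sqrtr ?fine_ge0 // -lee_fin fineK //.
by rewrite ge0_fin_numE //; case: Hf.
Qed.

Lemma integral_mul_indic (A : set R) (f : R -> R) : measurable A -> A `<=` D ->
  (\int[mu]_(x in D) (f x * \1_A x)%:E = \int[mu]_(x in A) (f x)%:E)%E.
Proof.
move=> mA AD.
rewrite -[in RHS](setIidr AD) integral_mkcondr; apply: eq_integral => x _.
by rewrite patchE indicE; case: ifP => _; rewrite ?mulr1 ?mulr0.
Qed.

End orthonormal.

(** * Orthonormal families on the interval and on the finite set *)

Section base_space.
Context {R : realType}.

Lemma inH_indic (D : set R) (mu : {measure set (measurableTypeR R) -> \bar R})
    (c : R) (A : set R) : measurable D -> measurable A -> A `<=` D -> (mu A < +oo)%E ->
  inH D mu (fun x => c * \1_A x).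
Proof.
move=> mD mA AD Aoo; split.
  by apply: measurable_funM => //; exact: measurable_indic.
rewrite (_ : (fun x => _) = (fun x => ((cst (c ^+ 2) x) * \1_A x)%:E)); last first.
  apply/funext => x; rewrite exprMn; congr (_ * _)%:E.
  by rewrite indicE; case: (_ \in _); rewrite ?expr1n ?expr0n.
rewrite integral_mul_indic // [X in (X < _)%E](integral_cst mu mA (c ^+ 2)%:E).
by apply: lte_mul_pinfty => //; rewrite lee_fin sqr_ge0.
Qed.

Lemma ip_indic (D : set R) (mu : {measure set (measurableTypeR R) -> \bar R})
    (c : R) (A : set R) f : measurable D -> measurable A -> A `<=` D ->
  ipH D mu f (fun x => c * \1_A x) = fine (\int[mu]_(x in A) (c * f x)%:E).
Proof.
move=> mD mA AD; congr fine; rewrite -(@integral_mul_indic _ D mu A (fun x => c * f x)) //.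
by apply: eq_integral => x _; congr EFin; ring.
Qed.

Lemma finite_counting_space (d : nat) :
  finite_set [set x : R | exists2 k : nat, (1 <= k <= d)%N & x = k%:R].
Proof.
have -> : [set x : R | exists2 k : nat, (1 <= k <= d)%N & x = k%:R] =
    (fun k => k%:R) @` [set k | (1 <= k <= d)%N].
  by apply/seteqP; split => [x [k kd ->]|x [k kd <-]]; exists k.
apply: finite_image; apply: (sub_finite_set _ (finite_II d.+1)) => k /= /andP[] //.
Qed.

Lemma measurable_finite_set (A : set R) : finite_set A -> measurable A.
Proof.
move=> fA; apply: countable_measurable; last exact: finite_set_countable.
by move=> t; exact: measurable_set1.
Qed.

Lemma counting_set1 (a : R) : counting [set a] = 1%:E :> \bar R.
Proof.
rewrite /counting asboolT; last exact: finite_set1.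
by rewrite fset_set1 finmap.cardfs1.
Qed.

Lemma base_space_finite (D : set R) (mu : {measure set (measurableTypeR R) -> \bar R}) :
  base_space D mu -> measurable D /\ (mu D < +oo)%E.
Proof.
move=> [[a [b [ab [-> E]]]]|[d [d0 [-> E]]]].
  split; first exact: measurable_itv.
  by rewrite E lebesgue_measure_itv /= lte_fin ab -EFinD ltry.
have fin := finite_counting_space d; split.
  exact: measurable_finite_set.
by rewrite E /counting asboolT // ltry.
Qed.

(** Points have mass 1, so the inner product with the indicator of a point is evaluation there, and
    every expansion equals [f] on [D]. *)
Lemma counting_approximation (D : set R) (mu : {measure set (measurableTypeR R) -> \bar R})
    (d : nat) : D = [set x | exists2 k : nat, (1 <= k <= d)%N & x = k%:R] ->
  (forall A, mu A = counting A) ->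
  exists (K : nat -> nat) (phi : forall n, 'I_(K n) -> R -> R),
  (forall n, orthonormal D mu (phi n)) /\
  forall f, inH D mu f ->
  {ae mu, forall x, D x -> expansion D mu (phi n) f x @[n --> \oo] --> f x}.
Proof.
move=> DE muE.
have mD : measurable D by rewrite DE; exact: measurable_finite_set (finite_counting_space d).
(* Ordinals start at 0, the points of [D] at 1. *)
pose pt (j : 'I_d) : R := (j.+1)%:R.
pose phi (n : nat) (j : 'I_d) : R -> R := fun x => 1 * \1_[set pt j] x.
have ptD j : [set pt j] `<=` D.
  by move=> _ ->; rewrite DE; exists j.+1 => //=.
have mpt j : measurable [set pt j] by exact: measurable_set1.
have ipE f n j : ipH D mu f (phi n j) = f (pt j).
  rewrite ip_indic //.
  rewrite (_ : \int[mu]_(x in [set pt j]) _ = \int[mu]_(x in [set pt j]) cst (f (pt j))%:E x)%E.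
    by rewrite integral_cst // muE counting_set1 mule1.
  by apply: eq_integral => x; rewrite inE => ->; rewrite mul1r.
have phiE n i j : phi n i (pt j) = (i == j)%:R.
  rewrite /phi mul1r indicE; congr (_%:R); congr nat_of_bool.
  apply/idP/idP; last by move=> /eqP ->; rewrite inE.
  by rewrite inE /= => /eqP; rewrite eqr_nat eqSS => /eqP /val_inj ->.
exists (fun=> d), phi; split => [n|f Hf].
  split => [j|i j]; last by rewrite ipE phiE.
  by apply: inH_indic => //; rewrite muE counting_set1 ltry.
apply: aeW => x Dx.
have [k /andP[k1 kd] ->] : exists2 k : nat, (1 <= k <= d)%N & x = k%:R.
  by move: Dx; rewrite DE.
have kd' : (k.-1 < d)%N by rewrite prednK.
have -> : k%:R = pt (Ordinal kd') by rewrite /pt /= prednK.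
rewrite (_ : (fun n => _) = cst (f (pt (Ordinal kd')))); first exact: cvg_cst.
apply/funext => n; rewrite /expansion (bigD1 (Ordinal kd')) //= ipE phiE eqxx mulr1.
by rewrite big1 ?addr0 // => i ij; rewrite phiE (negbTE ij) mulr0.
Qed.

(** The expansion at [x] is the average of [f] over the cell containing [x]. The cells shrink nicely
    to [x], so Lebesgue differentiation applies. *)
Lemma interval_approximation (a b : R) (mu : {measure set (measurableTypeR R) -> \bar R}) :
  a < b -> mu = [the {measure set (measurableTypeR R) -> \bar R} of @lebesgue_measure R] ->
  let D := `[a, b]%classic in
  exists (K : nat -> nat) (phi : forall n, 'I_(K n) -> R -> R),
  (forall n, orthonormal D mu (phi n)) /\
  forall f, inH D mu f ->
  {ae mu, forall x, D x -> expansion D mu (phi n) f x @[n --> \oo] --> f x}.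
Proof.
move=> ab muE D.
have mD : measurable D by exact: measurable_itv.
pose h n : R := (b - a) * n.+1%:R^-1.
have h0 n : 0 < h n by rewrite mulr_gt0 ?invr_gt0 // subr_gt0.
(* Half-open cells are disjoint, at the cost of missing the endpoint [b]. The index is real, so that
   integers outside the partition are allowed too. *)
pose J n (k : R) := `[a + h n * k, a + h n * (k + 1)[%classic : set R.
have mJ n k : measurable (J n k) by exact: measurable_itv.
have mJ' n k : @measurable _ (measurableTypeR R) (J n k) by exact: mJ.
have muJ n k : mu (J n k) = (h n)%:E.
  rewrite muE /= lebesgue_measure_itv /= lte_fin.
  have -> : a + h n * k < a + h n * (k + 1) by have := h0 n; nra.
  by rewrite -EFinD; congr EFin; ring.
have JD n (j : 'I_n.+1) : J n j%:R `<=` D.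
  move=> x; rewrite /J /D /= !in_itv /= => /andP[x1 x2].
  have hn : h n * n.+1%:R = b - a by rewrite /h mulfVK.
  have j0 : (0 : R) <= j%:R by [].
  have jn : j%:R + 1 <= n.+1%:R :> R by rewrite natr1 ler_nat.
  by have := h0 n; move=> hp; apply/andP; split; nra.
have Jdisj n (i j : 'I_n.+1) x : J n i%:R x -> J n j%:R x -> i = j.
  rewrite /J /= !in_itv /= => /andP[x1 x2] /andP[y1 y2].
  have hp := h0 n.
  have : i%:R < j%:R + 1 :> R by rewrite -(ltr_pM2l hp); lra.
  have : j%:R < i%:R + 1 :> R by rewrite -(ltr_pM2l hp); lra.
  rewrite !natr1 !ltr_nat !ltnS => ji ij.
  by apply/val_inj/eqP; rewrite eqn_leq ij ji.
(* Normalisation: the indicator of a cell has squared norm [h n]. *)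
pose c n := (Num.sqrt (h n))^-1.
have cc n : c n * c n = (h n)^-1.
  by rewrite /c -invfM -expr2 sqr_sqrtr // ltW.
pose phi n (j : 'I_n.+1) : R -> R := fun x => c n * \1_(J n j%:R) x.
have phi_in n j : inH D mu (phi n j).
  by apply: inH_indic => //; rewrite muJ ltry.
have phiJ n (i j : 'I_n.+1) x : J n j%:R x -> phi n i x = c n * (i == j)%:R.
  move=> Jx; rewrite /phi indicE; congr (_ * _%:R); congr nat_of_bool.
  apply/idP/eqP => [|->]; last by rewrite inE.
  by rewrite inE => Ix; exact: Jdisj Ix Jx.
have ipE n j f : ipH D mu f (phi n j) = fine (\int[mu]_(x in J n j%:R) (c n * f x)%:E).
  by rewrite ip_indic.
exists (fun n => n.+1), phi; split => [n|f Hf].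
  split=> [//|i j]; rewrite ipE.
  rewrite (_ : \int[mu]_(x in J n j%:R) _ =
     \int[mu]_(x in J n j%:R) cst ((h n)^-1 * (i == j)%:R)%:E x)%E.
    rewrite (integral_cst mu (mJ n j%:R)) muJ -EFinM /=.
    by rewrite mulrAC mulVf ?mul1r // gt_eqF.
  apply: eq_integral => x; rewrite inE => Jx /=.
  by rewrite (phiJ n i j x Jx) mulrA cc.
have one_in : inH D mu (cst 1).
  split => //; rewrite (eq_integral (cst 1%:E)); last by move=> x _; rewrite /= expr1n.
  rewrite integral_cst // mul1e muE /= lebesgue_measure_itv /= lte_fin ab.
  by rewrite -EFinD ltry.
have fint : mu.-integrable D (EFin \o f).
  have := inH_integrable_mul mD Hf one_in; congr (_.-integrable _ _).
  by apply/funext => x /=; rewrite mulr1.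
have loc : locally_integrable setT (f \_ D).
  by apply: integrable_locally_restrict => //; move: fint; rewrite muE.
pose E x n := J n (Num.floor ((x - a) / h n))%:~R.
have EB x n y : E x n y -> `|x - y| < h n.
  have := floor_itv ((x - a) / h n); rewrite /E; set k := Num.floor _.
  rewrite intrD => /andP[k1 k2].
  rewrite /J /= in_itv /= => /andP[y1 y2].
  have hp := h0 n.
  rewrite ler_pdivlMr // in k1; rewrite ltr_pdivrMr // in k2.
  by rewrite ltr_norml; apply/andP; split; lra.
have nice x : nicely_shrinking x (E x).
  split => [n|]; first exact: mJ.
  (* A cell of length [h n] containing [x] lies in the ball of radius [h n], whose measure is twice
     that of the cell. *)
  exists (2, (fun n => PosNum (h0 n))); split => //=.
  - rewrite -[X in _ --> X](mulr0 (b - a)).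
    apply: cvgM; first exact: cvg_cst.
    exact: cvg_harmonic.
  - by move=> n y /EB; rewrite /ball /=.
  - move=> n; rewrite lebesgue_measure_ball; last exact: ltW.
    have := muJ n (Num.floor ((x - a) / h n))%:~R; rewrite muE /= /E => ->.
    by rewrite -EFinM lee_fin mulr2n; lra.
have ae_b : {ae mu, forall x, x != b}.
  rewrite muE.
  exists [set b]; split; [exact: measurable_set1|exact: lebesgue_measure_set1|].
  by move=> x /= /negP; rewrite negbK => /eqP.
have ae_l : {ae mu, forall x, lebesgue_pt (f \_ D) x}.
  by rewrite muE; exact: lebesgue_differentiation.
apply: ae_imp2 ae_l ae_b => x lx xb Dx.
have := nice_lebesgue_differentiation nice loc lx.
rewrite patchE mem_set // => H.
have [xa xb'] : a <= x /\ x < b.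
  by move: Dx; rewrite /D /= in_itv /= => /andP[-> xb']; rewrite lt_neqAle xb xb'.
(* At [x] only the term of its own cell survives, and the two factors [c n] combine into the inverse
   of the length of that cell. *)
suff EE n : (expansion D mu (@phi n) f x)%:E =
    ((lebesgue_measure (E x n))^-1 * \int[lebesgue_measure]_(y in E x n) ((f \_ D) y)%:E)%E.
  by move: H; under eq_fun do rewrite -EE; move=> /fine_cvgP[_].
have hp := h0 n.
have fl0 : 0 <= Num.floor ((x - a) / h n).
  by rewrite floor_ge0 divr_ge0 ?subr_ge0 // ltW.
(* With [fl0], this makes the floor a valid index of the family; [x < b] is used here. *)
have fln : Num.floor ((x - a) / h n) < n.+1%:Z.
  rewrite floor_lt_int ltr_pdivrMr // mulrC /h.
  by rewrite -[(n.+1%:Z)%:~R]/(n.+1%:R : R) mulfVK //; lra.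
pose k := `|Num.floor ((x - a) / h n)|%N.
have kE : Num.floor ((x - a) / h n) = k%:Z by rewrite /k gez0_abs.
have kn : (k < n.+1)%N by rewrite kE in fln.
pose j : 'I_n.+1 := Ordinal kn.
have EJ : E x n = J n j%:R by rewrite /E kE.
have Jx : J n j%:R x.
  rewrite -EJ /E /J /= in_itv /=.
  have := floor_itv ((x - a) / h n); rewrite intrD => /andP[k1 k2].
  rewrite ler_pdivlMr // in k1; rewrite ltr_pdivrMr // in k2.
  by apply/andP; split; lra.
have fintJ : mu.-integrable (J n j%:R) (EFin \o f).
  exact: (@integrableS _ (measurableTypeR R) R mu D (J n j%:R) _ mD (mJ n j%:R) (JD n j) fint).
have := muJ n j%:R; rewrite {1}muE /= EJ => ->.
rewrite (_ : \int[lebesgue_measure]_(y in J n j%:R) _ = \int[mu]_(y in J n j%:R) (f y)%:E)%E; last first.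
  by rewrite muE; apply: eq_integral => y; rewrite inE => Jy; rewrite patchE mem_set //; exact: (JD n j).
rewrite -(fineK (integrable_fin_num (mJ' n j%:R) fintJ)).
rewrite /expansion (bigD1 j) //= (phiJ n j j x Jx) eqxx mulr1 big1 ?addr0; last first.
  by move=> i ij; rewrite (phiJ n i j x Jx) (negbTE ij) !mulr0.
rewrite ipE inver gt_eqF // -EFinM; congr EFin.
rewrite [fine _](RintegralZl (mu := mu) (c n) (mJ' n j%:R) fintJ) /Rintegral.
by rewrite mulrAC cc.
Qed.

Lemma base_space_approximation (D : set R) (mu : {measure set (measurableTypeR R) -> \bar R}) :
  base_space D mu ->
  exists (K : nat -> nat) (phi : forall n, 'I_(K n) -> R -> R),
  (forall n, orthonormal D mu (phi n)) /\
  forall f, inH D mu f ->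
  {ae mu, forall x, D x -> expansion D mu (phi n) f x @[n --> \oo] --> f x}.
Proof.
move=> [[a [b [ab [-> E]]]]|[d [_ [DE muE]]]]; last exact: counting_approximation DE muE.
apply: interval_approximation => //.
by apply: eq_measure; apply/funext => A; exact: E.
Qed.

End base_space.

Unset Implicit Arguments.
Set Strict Implicit.

(** * The noise term *)

(** Continuity from above along the decreasing unions of tails, each of which has probability at
    least [p]. *)
Lemma probability_limsup_ge d (T : measurableType d) (R : realType)
    (P : probability T R) (A : nat -> set T) (p : \bar R) :
  (forall n, measurable (A n)) -> (forall n, p <= P (A n))%E ->
  (p <= P (\bigcap_m \bigcup_(n in [set n | (m <= n)%N]) A n))%E.
Proof.
move=> mA pA; pose U m := \bigcup_(n in [set n | (m <= n)%N]) A n.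
have mU m : measurable (U m) by apply: bigcup_measurable => n _.
have cvgU : P (U m) @[m --> \oo] --> P (\bigcap_m U m).
  apply: nonincreasing_cvg_mu => //.
  - by apply: le_lt_trans (ltry 1); exact: probability_le1.
  - by apply: bigcapT_measurable.
  - move=> m n mn; apply/subsetPset => x [k /= nk Ak].
    by exists k => //=; exact: leq_trans mn nk.
rewrite -(cvg_lim _ cvgU) //; apply: lime_ge; first by apply/cvg_ex; eexists; exact: cvgU.
apply: nearW => m; apply: le_trans (pA m) _.
by apply: le_measure; rewrite ?inE // => x Ax; exists m => //=.
Qed.

Section error_concentration.
Context {R : realType} (D : set R) (mu : {measure set (measurableTypeR R) -> \bar R}).
Hypothesis HX : base_space D mu.
Context (dO : measure_display) (Omega : measurableType dO) (P : probability Omega R).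
Variables (N : nat) (eps : nat -> Omega -> R -> R) (sigma : R) (g : nat -> R).
Hypothesis Hsigma : 0 < sigma.
Hypothesis eps_re : forall i, (1 <= i <= N)%N -> H_random_element D mu (eps i).
Hypothesis eps_indep : mutually_independent D mu P N eps.
Hypothesis eps_mean : forall i, (1 <= i <= N)%N -> mean_zero D mu P (eps i).
Hypothesis eps_bdd : forall i, (1 <= i <= N)%N ->
  {ae P, forall w, normH D mu (eps i w) <= sigma}.
Hypothesis g0 : 0 < \sum_(1 <= i < N.+1) g i ^+ 2.

(** The generator inside [gen_sigma (eps i)], named so that [eps_indep] is literally the
    independence hypothesis of the concentration results. *)
Definition functional_events i : set (set Omega) :=
  [set A | exists h, inH D mu h /\
     exists2 B : set R, measurable B & A = (fun w => ipH D mu (eps i w) h) @^-1` B].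

Lemma functional_events_measurable i : (1 <= i <= N)%N ->
  <<s functional_events i >> `<=` measurable.
Proof.
move=> iN; apply: smallest_sub; first exact: sigma_algebra_measurable.
move=> _ [h [Hh [B mB ->]]].
have [_ /(_ h Hh) m] := eps_re i iN.
by rewrite -[_ @^-1` _]setTI; exact: m.
Qed.

Lemma measurable_functional i h : inH D mu h ->
  measurable_fun (setT : set (g_sigma_algebraType (functional_events i)))
    (fun w => ipH D mu (eps i w) h).
Proof.
by move=> Hh _ B mB; rewrite setTI; apply: sub_sigma_algebra; exists h; split => //; exists B.
Qed.

Section finite_dim.
Variables (k : nat) (phi : 'I_k -> R -> R).
Hypothesis on : orthonormal D mu phi.

Let V i j w := ipH D mu (eps i w) (phi j).
(* Truncation turns the almost sure bound into a sure one. *)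
Let X i j w := if \sum_j V i j w ^+ 2 <= sigma ^+ 2 then g i * V i j w else 0.

(** By Bessel's inequality the truncation is inactive once the norms are at most [sigma]. *)
Lemma truncation_id w : (forall i, (1 <= i <= N)%N -> normH D mu (eps i w) <= sigma) ->
  forall i j, (1 <= i <= N)%N -> X i j w = g i * V i j w.
Proof.
have [mD _] := base_space_finite HX.
move=> bd i j iN; rewrite /X ifT //.
apply: (@le_trans _ _ (normH D mu (eps i w) ^+ 2)).
  by apply: bessel => //; case: (eps_re i iN).
by rewrite ler_pXn2r ?nnegrE ?normH_ge0 ?(ltW Hsigma) //; exact: bd.
Qed.

Lemma projected_error_tail (delta : R) : 0 < delta ->
  measurable [set w | sum_norm X N w <= delta * (sigma * Num.sqrt (\sum_(1 <= i < N.+1) g i ^+ 2))] /\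
  ((1 - 2 * expR (- (delta ^+ 2) / 2))%:E <=
   P [set w | (sum_norm X N w <= delta * (sigma * Num.sqrt (\sum_(1 <= i < N.+1) g i ^+ 2)))%R])%E.
Proof.
move=> d0; have [Hphi _] := on.
pose c i := `|g i| * sigma.
have sB : Num.sqrt (\sum_(1 <= i < N.+1) c i ^+ 2) =
    sigma * Num.sqrt (\sum_(1 <= i < N.+1) g i ^+ 2).
  rewrite -[X in X * _](ger0_norm (ltW Hsigma)) -sqrtr_sqr -sqrtrM ?sqr_ge0 //.
  congr Num.sqrt; rewrite mulr_sumr; apply: eq_bigr => i _.
  by rewrite /c exprMn real_normK ?num_real // mulrC.
have mV i j := measurable_functional i (phi j) (Hphi j).
have mX i j : (1 <= i <= N)%N ->
    measurable_fun (setT : set (g_sigma_algebraType (functional_events i))) (X i j).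
  move=> iN; apply: measurable_fun_ifT.
  - apply: measurable_fun_ler; last exact: measurable_cst.
    by apply: measurable_sum => j'; apply: measurable_funX; exact: mV.
  - by apply: measurable_funM; [exact: measurable_cst|exact: mV].
  - exact: measurable_cst.
(* Truncation changes the coordinate on a null set only, so it stays centred. *)
have X0 i j : (1 <= i <= N)%N -> (\int[P]_w (X i j w)%:E = 0)%E.
  move=> iN.
  have [mD _] := base_space_finite HX.
  have -> : (\int[P]_w (X i j w)%:E = \int[P]_w ((g i)%:E * (V i j w)%:E))%E.
    apply: ae_eq_integral_nonmeasurable => //.
    apply: ae_imp (eps_bdd i iN) => w bd _; rewrite /X ifT ?EFinM //.
    apply: (@le_trans _ _ (normH D mu (eps i w) ^+ 2)).
      by apply: bessel => //; case: (eps_re i iN).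
    by rewrite ler_pXn2r ?nnegrE ?normH_ge0 ?(ltW Hsigma).
  have mVi : measurable_fun setT (V i j) by case: (eps_re i iN) => _; exact.
  have iV : P.-integrable setT (EFin \o V i j).
    apply/integrableP; split; first exact/measurable_EFinP.
    apply: (@le_lt_trans _ _ (\int[P]_w (cst sigma%:E w))%E).
      apply: ge0_le_integral_ae => //.
        by move=> w _; rewrite lee_fin ltW.
      apply: ae_imp (eps_bdd i iN) => w bd _; rewrite /= lee_fin.
      rewrite -(@ler_pXn2r _ 2) ?nnegrE ?(ltW Hsigma) // real_normK ?num_real //.
      apply: (@le_trans _ _ (normH D mu (eps i w) ^+ 2)).
        apply: (@le_trans _ _ (\sum_j V i j w ^+ 2)).
          by rewrite (bigD1 j) //= lerDl; apply: sumr_ge0 => ? _; exact: sqr_ge0.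
        by apply: bessel => //; case: (eps_re i iN).
      by rewrite ler_pXn2r ?nnegrE ?normH_ge0 ?(ltW Hsigma).
    by rewrite integral_cst //= probability_setT mule1 ltry.
  by rewrite integralZl // (eps_mean i iN) ?mule0.
have c0 i : 0 <= c i by rewrite mulr_ge0 // ltW.
have Xc i w : (1 <= i <= N)%N -> \sum_j X i j w ^+ 2 <= c i ^+ 2.
  move=> iN; rewrite /X /c exprMn real_normK ?num_real //.
  have [h|_] := boolP (\sum_j V i j w ^+ 2 <= sigma ^+ 2).
    under eq_bigr do rewrite exprMn.
    by rewrite -mulr_sumr; apply: ler_wpM2l => //; exact: sqr_ge0.
  rewrite big1 => [|j _]; last by rewrite expr0n.
  by apply: mulr_ge0; exact: sqr_ge0.
have Gm := functional_events_measurable.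
have B0 : 0 < \sum_(1 <= i < N.+1) c i ^+ 2.
  by rewrite -sqrtr_gt0 sB mulr_gt0 // sqrtr_gt0.
have tail := sum_norm_tail _ _ _ P functional_events N k Gm eps_indep X c mX X0 c0 Xc delta d0 B0.
rewrite sB in tail.
have mS := measurable_sum_norm _ _ _ functional_events N k Gm X mX N (leqnn N).
set r := delta * _ in tail *.
have mA : measurable [set w | r < sum_norm X N w].
  have := measurable_fun_ltr (measurable_cst r) mS.
  move=> /(_ measurableT [set true]) /= /(_ Logic.I); rewrite setTI.
  by congr measurable; apply/seteqP; split.
have -> : [set w | sum_norm X N w <= r] = ~` [set w | r < sum_norm X N w].
  by apply/seteqP; split => w /=; rewrite leNgt => /negP.
split; first exact: measurableC.
rewrite probability_setC // EFinB.
by apply: leeB.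
Qed.

(** Without active truncation, linearity turns the coordinates of the sum into those of the combined
    error. *)
Lemma sum_norm_truncation w : (forall i, (1 <= i <= N)%N -> normH D mu (eps i w) <= sigma) ->
  0 <= sum_norm X N w /\
  sum_norm X N w ^+ 2 =
  \sum_j ipH D mu (fun x => \sum_(1 <= i < N.+1) g i * eps i w x) (phi j) ^+ 2.
Proof.
have [mD _] := base_space_finite HX; have [Hphi _] := on.
move=> bd; split; first exact: sum_norm_ge0.
rewrite sum_norm_sqr; apply: eq_bigr => j _; congr (_ ^+ 2).
rewrite ipH_suml //; last first.
  move=> i; rewrite mem_index_iota ltnS => iN; by case: (eps_re i iN).
by apply: eq_big_nat => i iN; apply: truncation_id.
Qed.

End finite_dim.

Lemma error_norm_concentration (delta : R) : 0 < delta ->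
  exists2 A : set Omega, measurable A /\
    ((1 - 2 * expR (- (delta ^+ 2) / 2))%:E <= P A)%E &
  forall w, A w -> normH D mu (fun x => \sum_(1 <= i < N.+1) g i * eps i w x) <=
    delta * (sigma * Num.sqrt (\sum_(1 <= i < N.+1) g i ^+ 2)).
Proof.
move=> d0; have [mD _] := base_space_finite HX.
have [K [phi [on cvg]]] := base_space_approximation HX.
pose An n := [set w | sum_norm (fun i j w =>
   if \sum_j ipH D mu (eps i w) (phi n j) ^+ 2 <= sigma ^+ 2 then
   g i * ipH D mu (eps i w) (phi n j) else 0) N w <=
   delta * (sigma * Num.sqrt (\sum_(1 <= i < N.+1) g i ^+ 2))].
have mAn n : measurable (An n) by case: (projected_error_tail _ _ (on n) delta d0).
have pAn n : ((1 - 2 * expR (- (delta ^+ 2) / 2))%:E <= P (An n))%E.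
  by case: (projected_error_tail _ _ (on n) delta d0).
have : {ae P, forall w, forall i, (1 <= i <= N)%N -> normH D mu (eps i w) <= sigma}.
  apply: ae_foralln => i; have [iN|iN] := boolP (1 <= i <= N)%N; last exact: aeW.
  by apply: ae_imp (eps_bdd i iN) => w.
move=> [Z [mZ Z0 badZ]].
(* [L] is the event that infinitely many projections are small. Removing the null set [Z], on which
   some error may exceed [sigma], does not lower its probability. *)
pose L := \bigcap_m \bigcup_(n in [set n | (m <= n)%N]) An n.
have mL : measurable L.
  by apply: bigcapT_measurable => m; apply: bigcup_measurable.
exists (L `\` Z).
  split; first exact: measurableD.
  apply: le_trans (probability_limsup_ge _ _ _ P An _ mAn pAn) _.
  rewrite -/L; apply: (@le_trans _ _ (P ((L `\` Z) `|` Z))).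
    apply: le_measure; rewrite ?inE //; first by apply: measurableU => //; exact: measurableD.
    by move=> w Lw; have [Zw|Zw] := pselect (Z w); [right|left].
  apply: le_trans (measureU2 _ _ _) _ => //; first exact: measurableD.
  by rewrite [X in (_ + X)%E]Z0 adde0.
move=> w [Lw Zw].
have bd : forall i, (1 <= i <= N)%N -> normH D mu (eps i w) <= sigma.
  by apply: contrapT => nb; apply: Zw; exact: badZ.
apply: (normH_le_of_expansion_cvg mD on).
- by apply: inH_sum => // i; rewrite mem_index_iota ltnS => iN; case: (eps_re i iN).
- apply: cvg; apply: inH_sum => // i; rewrite mem_index_iota ltnS => iN.
  by case: (eps_re i iN).
- by rewrite !mulr_ge0 ?sqrtr_ge0 // ltW.
- move=> m; have [n /= mn Anw] := Lw m Logic.I; exists n => //.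
  have [s0 <-] := sum_norm_truncation _ _ (on n) w bd.
  by rewrite ler_pXn2r ?nnegrE //; apply: le_trans Anw.
Qed.

End error_concentration.

(** * The autoregressive part and the final bound *)

Lemma ae_section_linear (R : realType) (D : set R)
    (mu : {measure set (measurableTypeR R) -> \bar R}) (mD : measurable D)
    (muD : (mu D < +oo)%E) (N T0 : nat) (beta : nat -> R * R -> R)
    (Y : nat -> nat -> R -> R) (gamma : nat -> R) : (1 <= N)%N ->
  (forall t, (1 <= t <= T0)%N -> inHH D mu (beta t)) ->
  (forall i t, (1 <= i <= N)%N -> (1 <= t <= T0)%N -> inH D mu (Y i t)) ->
  eqH D mu
    (fun x => \sum_(1 <= t < T0.+1) ipH D mu (fun y => beta t (x, y)) (Y 1%N t) -
       \sum_(2 <= i < N.+1) gamma i *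
         \sum_(1 <= t < T0.+1) ipH D mu (fun y => beta t (x, y)) (Y i t))
    (fun x => \sum_(1 <= t < T0.+1) ipH D mu (fun y => beta t (x, y))
       (Y 1%N t \- (fun y => \sum_(2 <= i < N.+1) gamma i * Y i t y))).
Proof.
move=> N1 Hb HY.
(* Linearity of the inner product is available only where the sections of all the [beta t] lie in
   [H], that is, for almost every [x]. *)
have : {ae mu, forall x, forall t, (1 <= t <= T0)%N -> D x ->
    inH D mu (fun y => beta t (x, y))}.
  apply: ae_foralln => t; have [tT|tT] := boolP (1 <= t <= T0)%N; last exact: aeW.
  by apply: ae_imp (ae_section_inH mD muD (Hb t tT)).
apply: ae_imp => x hx Dx.
under [X in _ - X]eq_bigr do rewrite mulr_sumr.
rewrite exchange_big /= -sumrB; apply: eq_big_nat => t tT.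
have hbt := hx t tT Dx.
have HYi i : i \in index_iota 2 N.+1 -> inH D mu (Y i t).
  by rewrite mem_index_iota ltnS => /andP[i2 iN]; apply: HY => //; rewrite iN (ltnW i2).
rewrite [RHS]ipHC ipHBl //; last 2 first.
- exact: HY.
- exact: inH_sum.
rewrite ipH_suml // [in RHS]ipHC; congr (_ - _).
by apply: eq_bigr => i _; rewrite [in RHS]ipHC.
Qed.

Theorem theorem1
  (R : realType) (D : set R) (mu : {measure set (measurableTypeR R) -> \bar R})
  (HX : base_space D mu)
  (* the metric space (M, dist) and the isometry Psi : M -> H *)
  (M : Type) (dist : M -> M -> R) (Psi : M -> R -> R)
  (Psi_inH : forall a, inH D mu (Psi a))
  (Psi_iso : forall a b, dist a b = normH D mu (Psi a \- Psi b))
  (dist_sep : forall a b, dist a b = 0 -> a = b)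
  (Y_nonempty : exists a : M, True)
  (Y_closed : forall (s : nat -> M) (f : R -> R), inH D mu f ->
     (fun n => normH D mu (Psi (s n) \- f)) @ \oo --> (0 : R^o) ->
     exists a, eqH D mu (Psi a) f)
  (Y_convex : forall (a b : M) (l : R), 0 <= l <= 1 ->
     exists c, eqH D mu (Psi c) (fun x => l * Psi a x + (1 - l) * Psi b x))
  (* panel: N units, T0 pre-treatment periods, T = T0 + 1 *)
  (N T0 : nat) (HT0 : (1 <= T0)%N)
  (* fixed pre-treatment outcomes Y_it = Y^N_it, t <= T0 *)
  (Y : nat -> nat -> R -> R)
  (Y_in : forall i t, (1 <= i <= N)%N -> (1 <= t <= T0)%N ->
     exists a, eqH D mu (Psi a) (Y i t))
  (* coefficient functions *)
  (beta : nat -> R * R -> R)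
  (beta_in : forall t, (1 <= t <= T0)%N -> inHH D mu (beta t))
  (* probability space and errors *)
  (dO : measure_display) (Omega : measurableType dO) (P : probability Omega R)
  (eps : nat -> Omega -> R -> R) (sigma : R) (Hsigma : 0 < sigma)
  (eps_re : forall i, (1 <= i <= N)%N -> H_random_element D mu (eps i))
  (eps_indep : mutually_independent D mu P N eps)
  (eps_mean : forall i, (1 <= i <= N)%N -> mean_zero D mu P (eps i))
  (eps_bdd : forall i, (1 <= i <= N)%N ->
     {ae P, forall w, normH D mu (eps i w) <= sigma})
  (* post-treatment control potential outcomes Y^N_iT (random) *)
  (YNT : nat -> Omega -> R -> R)
  (YNT_in : forall i w, (1 <= i <= N)%N -> exists a, eqH D mu (Psi a) (YNT i w))
  (model : forall i w, (1 <= i <= N)%N ->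
     eqH D mu (YNT i w)
       (fun x => \sum_(1 <= t < T0.+1) ipH D mu (fun y => beta t (x, y)) (Y i t)
                 + eps i w x))
  (* counterfactual nu^N_1T = Psi^{-1}(Y^N_1T) *)
  (nu : Omega -> M) (Hnu : forall w, eqH D mu (Psi (nu w)) (YNT 1%N w))
  (* fixed weights *)
  (gamma : nat -> R) (Hgamma : \sum_(2 <= i < N.+1) gamma i = 1)
  (* estimator: Psi (nuhat w) is the metric projection onto Psi(M) of
     hat Y^N_1T = sum_{i>=2} gamma_i Y_iT, where Y_iT = Y^N_iT for i >= 2 *)
  (nuhat : Omega -> M)
  (Hnuhat : forall w (a : M),
     normH D mu (Psi (nuhat w) \- (fun x => \sum_(2 <= i < N.+1) gamma i * YNT i w x))
     <= normH D mu (Psi a \- (fun x => \sum_(2 <= i < N.+1) gamma i * YNT i w x)))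
  (delta : R) (Hdelta : 0 < delta) :
  exists2 A : set Omega, measurable A /\
      ((1 - 2 * expR (- (delta ^+ 2) / 2))%:E <= P A)%E &
    forall w, A w ->
      dist (nu w) (nuhat w) <=
        Num.sqrt (\sum_(1 <= t < T0.+1) normHH D mu (beta t) ^+ 2) *
        Num.sqrt (\sum_(1 <= t < T0.+1)
           normH D mu (fun x => Y 1%N t x - \sum_(2 <= i < N.+1) gamma i * Y i t x) ^+ 2)
        + delta * sigma * (1 + Num.sqrt (\sum_(2 <= i < N.+1) gamma i ^+ 2)).
Proof.
have [mD muD] := base_space_finite HX.
(* An empty sum of weights could not equal 1. *)
have N2 : (2 <= N)%N.
  rewrite leqNgt; apply/negP => N1; move: Hgamma; rewrite big_geq // => /esym/eqP.
  by rewrite oner_eq0.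
have N1 : (1 <= 1 <= N)%N by rewrite (ltnW N2).
have range2 i : i \in index_iota 2 N.+1 -> (1 <= i <= N)%N.
  by rewrite mem_index_iota ltnS => /andP[i2 ->]; rewrite (ltnW i2).
(* Signed weights for which the combined error is that of unit 1 minus the weighted errors of the
   controls. *)
pose g i := if i == 1%N then 1 else - gamma i.
have gE : {in index_iota 2 N.+1, forall i, g i = - gamma i}.
  by move=> i; rewrite mem_index_iota /g => /andP[i2 _]; rewrite gtn_eqF.
have g2 : \sum_(1 <= i < N.+1) g i ^+ 2 = 1 + \sum_(2 <= i < N.+1) gamma i ^+ 2.
  rewrite big_ltn ?(ltnW N2) // {1}/g eqxx expr1n; congr (_ + _).
  by apply: eq_big_seq => i /gE ->; rewrite sqrrN.
have G0 : 0 <= \sum_(2 <= i < N.+1) gamma i ^+ 2.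
  by apply: sumr_ge0 => i _; exact: sqr_ge0.
have gp : 0 < \sum_(1 <= i < N.+1) g i ^+ 2 by rewrite g2 ltr_pwDl.
have [A [mA PA] bound] := error_norm_concentration D mu HX dO Omega P N eps sigma g
  Hsigma eps_re eps_indep eps_mean eps_bdd gp delta Hdelta.
exists A => // w /bound {bound}; set e := fun x => \sum_(1 <= i < N.+1) g i * eps i w x.
move=> ebound.
(* [Y i t] is known only up to almost-everywhere equality with a point of the image. [Y'] selects
   genuine members of [H]; the value 0 off the panel is a placeholder. *)
have exY (it : nat * nat) : exists y : R -> R, (1 <= it.1 <= N)%N ->
    (1 <= it.2 <= T0)%N -> inH D mu y /\ eqH D mu y (Y it.1 it.2).
  case: it => i t /=.
  have [/andP[iN tT]|h] := boolP ((1 <= i <= N)%N && (1 <= t <= T0)%N).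
    by have [a ea] := Y_in i t iN tT; exists (Psi a).
  by exists (cst 0) => iN tT; move: h; rewrite iN tT.
have [Y' HY'] := choice exY.
have Y'in i t : (1 <= i <= N)%N -> (1 <= t <= T0)%N -> inH D mu (Y' (i, t)).
  by move=> iN tT; case: (HY' (i, t) iN tT).
have Y'E i t : (1 <= i <= N)%N -> (1 <= t <= T0)%N -> eqH D mu (Y' (i, t)) (Y i t).
  by move=> iN tT; case: (HY' (i, t) iN tT).
have exZ (i : nat) : exists z : R -> R, (1 <= i <= N)%N ->
    inH D mu z /\ eqH D mu z (YNT i w).
  have [iN|h] := boolP (1 <= i <= N)%N; last by exists (cst 0).
  by have [a ea] := YNT_in i w iN; exists (Psi a).
have [Z HZ] := choice exZ.
pose v x := \sum_(2 <= i < N.+1) gamma i * Z i x.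
have Hv : inH D mu v by apply: inH_sum => // i /range2 /HZ[].
have vE : eqH D mu v (fun x => \sum_(2 <= i < N.+1) gamma i * YNT i w x).
  by apply: eqH_sum => i /range2 /HZ[].
pose p := Psi (nu w); pose q := Psi (nuhat w).
(* Convexity supplies, for each point of the segment from [q] to [p], a point of [M] against which
   [nuhat w] is optimal. *)
have pq : dist (nu w) (nuhat w) <= normH D mu (p \- v).
  rewrite Psi_iso; apply: normH_projection_le => // l l01.
  have [c cE] := Y_convex (nu w) (nuhat w) l l01.
  have := Hnuhat w c.
  rewrite -(normH_eqH mD (eqHB (eqH_refl _ _ q) vE)).
  by rewrite (normH_eqH mD (eqHB cE (eqH_sym vE))).
apply: (le_trans pq).
have ein : inH D mu e.
  apply: inH_sum => // i; rewrite mem_index_iota ltnS => iN.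
  by case: (eps_re i iN).
pose U t := Y' (1%N, t) \- (fun y => \sum_(2 <= i < N.+1) gamma i * Y' (i, t) y).
have HU t : (1 <= t <= T0)%N -> inH D mu (U t).
  move=> tT; apply: inHB => //; first exact: Y'in.
  by apply: inH_sum => // i /range2 iN; exact: Y'in.
have UE t : (1 <= t <= T0)%N -> normH D mu (U t) =
    normH D mu (fun x => Y 1%N t x - \sum_(2 <= i < N.+1) gamma i * Y i t x).
  move=> tT; apply: normH_eqH => //; apply: eqHB; first exact: Y'E.
  by apply: eqH_sum => i /range2 iN; exact: Y'E.
pose Ax x := \sum_(1 <= t < T0.+1) ipH D mu (fun y => beta t (x, y)) (U t).
(* Once the noise [e] is subtracted, the model leaves the integral operators applied to the
   pre-treatment imbalances [U t]. *)
have AE : eqH D mu ((p \- v) \- e) Ax.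
  have h1 : eqH D mu p (fun x => \sum_(1 <= t < T0.+1)
      ipH D mu (fun y => beta t (x, y)) (Y' (1%N, t)) + eps 1%N w x).
    apply: eqH_trans (Hnu w) _; apply: eqH_trans (model 1%N w N1) _.
    apply: aeW => x _; congr (_ + _); apply: eq_big_nat => t tT.
    by apply: ipH_eqH => //; [exact: eqH_refl|apply: eqH_sym; exact: Y'E].
  have h2 : eqH D mu v (fun x => \sum_(2 <= i < N.+1) gamma i *
      (\sum_(1 <= t < T0.+1) ipH D mu (fun y => beta t (x, y)) (Y' (i, t)) + eps i w x)).
    apply: eqH_sum => i /range2 iN; apply: eqH_trans (HZ i iN).2 _.
    apply: eqH_trans (model i w iN) _.
    apply: aeW => x _; congr (_ + _); apply: eq_big_nat => t tT.
    by apply: ipH_eqH => //; [exact: eqH_refl|apply: eqH_sym; exact: Y'E].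
  have h3 := ae_section_linear R D mu mD muD N T0 beta (fun i t => Y' (i, t)) gamma
    (ltnW N2) beta_in Y'in.
  apply: eqH_trans (eqHB (eqHB h1 h2) (eqH_refl _ _ e)) _.
  apply: ae_imp h3 => x h3 Dx; rewrite /Ax -(h3 Dx) /=.
  have -> : e x = eps 1%N w x - \sum_(2 <= i < N.+1) gamma i * eps i w x.
    rewrite /e big_ltn ?(ltnW N2) // {1}/g eqxx mul1r; congr (_ + _).
    by rewrite -sumrN; apply: eq_big_seq => i /gE ->; rewrite mulNr.
  under [X in _ - X - _]eq_bigr do rewrite mulrDr.
  by rewrite [X in _ - X - _]big_split /=; ring.
have Hpv : inH D mu (p \- v) by apply: inHB => //; exact: Psi_inH.
have Abound := normH_integral_operator_le mD muD beta_in HU.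
have -> : p \- v = ((p \- v) \- e) \+ e by apply/funext => x /=; ring.
apply: le_trans (normH_triangle mD (inHB mD Hpv ein) ein) _.
apply: lerD.
  rewrite (normH_eqH mD AE); apply: le_trans Abound _.
  rewrite le_eqVlt; apply/orP; left; apply/eqP; congr (_ * Num.sqrt _).
  by apply: eq_big_nat => t tT; rewrite UE.
(* It remains to see that [sqrt (1 + |gamma|^2) <= 1 + |gamma|]. *)
apply: le_trans ebound _; rewrite mulrA; apply: ler_wpM2l.
  by rewrite mulr_ge0 // ltW.
rewrite g2 -(@ler_pXn2r _ 2) ?nnegrE ?addr_ge0 ?sqrtr_ge0 //.
rewrite sqr_sqrtr ?addr_ge0 // sqrrD expr1n sqr_sqrtr // mul1r.
by have := sqrtr_ge0 (\sum_(2 <= i < N.+1) gamma i ^+ 2); lra.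
Qed.
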